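(* Let $\Phi^{(v)}=\{\varphi_\tau\}_{\tau\in\overline{E}^{(v)}}$ be the iterated function system on $X_v=[-\tfrac12,\tfrac12]$ whose alphabet is $$\overline{E}^{(v)}=\{e\in\mathbb{Z}:|e|>2\}\cup\{2^n e: e\in\mathbb{Z},\,e>2,\,n\geq1\}\cup\{(-2)^n f: f\in\mathbb{Z},\,f<-2,\,n\geq1\},$$ where $2^ne$ and $(-2)^nf$ denote words (the letter $2$, respectively $-2$, repeated $n$ times followed by the letter $e$, respectively $f$). Then $\Phi^{(v)}$ has full Hausdorff dimension spectrum; that is, for every real $t$ with $0\leq t\leq\dim_H(J_{\overline{E}^{(v)}})$ there exists a subset $D\subseteq\overline{E}^{(v)}$ such that $\dim_H(J_D)=t$.
   Context: $\dim_H$ denotes Hausdorff dimension. For an integer $b$ with $|b|\geq2$ put $\varphi_b(x)=\frac{1}{b+x}$, with domain $[0,\tfrac12]$ if $b=2$, domain $[-\tfrac12,0]$ if $b=-2$, and domain $[-\tfrac12,\tfrac12]$ if $|b|\geq3$. For a word $\tau=\tau_1\ldots\tau_m\in\overline{E}^{(v)}$ (with $\tau_i\in\mathbb{Z}$, $|\tau_i|\ge2$), the generator $\varphi_\tau:[-\tfrac12,\tfrac12]\to[-\tfrac12,\tfrac12]$ is $\varphi_\tau=\varphi_{\tau_1}\circ\cdots\circ\varphi_{\tau_m}$; this is well defined because $\varphi_e([-\frac12,\frac12])\subset[0,\tfrac12]$ for $e>2$, $\varphi_2([0,\frac12])\subset[0,\frac12]$, and symmetrically for negative letters. (These words are the first-return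 loops based at the vertex $v$ in the graph directed Markov system describing the nearest integer continued fraction.) For $D\subseteq\overline{E}^{(v)}$, the limit set $J_D\subseteq[-\tfrac12,\tfrac12]$ is the set of all points $\pi(\omega)$ with $\omega=\omega_1\omega_2\ldots\in D^\infty$ (each $\omega_i\in D$), where $\pi(\omega)$ is the unique element of $\bigcap_{n\geq1}\varphi_{\omega_1}\circ\cdots\circ\varphi_{\omega_n}([-\tfrac12,\tfrac12])$. An iterated function system with alphabet $I$ has full Hausdorff dimension spectrum if for each $t\in[0,\dim_H(J_I)]$ there is a subset $D\subseteq I$ with $\dim_H(J_D)=t$. *)

(* Defs.v *)
From HB Require Import structures.
From mathcomp Require Import all_boot all_order all_algebra.
From mathcomp Require Import all_classical all_reals all_analysis.
From mathcomp Require Import zify lra.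

Set Implicit Arguments.
Unset Strict Implicit.
Unset Printing Implicit Defensive.

Import Order.TTheory GRing.Theory Num.Theory.

Local Open Scope classical_set_scope.
Local Open Scope ring_scope.

Section Hausdorff.
Context {R : realType}.
Implicit Types (A U : set R) (s t : R).

(* [-oo] on [set0], so that [set0] satisfies every bound on the diameter *)
Definition diam U : \bar R :=
  ereal_sup [set `|p.1 - p.2|%:E | p in U `*` U].

(* Nonempty sets of diameter 0 have weight [0 `^ 0 = 1] when [s = 0], so that
   the case [s = 0] is counting measure; empty members of a cover are free. *)
Definition hausdorff_weight s U : \bar R :=
  if U == set0 then 0%E else poweR (diam U) s.

Definition hausdorff_premeasure s (delta : R) A : \bar R :=
  ereal_inf [set (\sum_(0 <= i <oo) hausdorff_weight s (F i))%E
    | F in [set F : (set R)^nat | A `<=` \bigcup_i F i /\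
                                  forall i, (diam (F i) <= delta%:E)%E]].

Definition hausdorff_measure s A : \bar R :=
  ereal_sup [set hausdorff_premeasure s delta A | delta in [set d | 0 < d]].

(* In particular the dimension of [set0] is 0. *)
Definition hausdorff_dim A : \bar R :=
  ereal_inf [set s%:E | s in [set s | 0 <= s /\ hausdorff_measure s A = 0%E]].

End Hausdorff.

Section IteratedFunctionSystem.
Context {R : realType} {I : Type}.
Variables (X : set R) (f : I -> R -> R).

(* [f (w 0) \o f (w 1) \o ... \o f (w n.-1)] *)
Definition ifs_prefix (w : nat -> I) (n : nat) : R -> R :=
  \big[comp/id]_(i < n) f (w i).

Definition limit_set (D : set I) : set R :=
  [set x | exists2 w : nat -> I, (forall i, D (w i)) &
     \bigcap_(n in [set n | (1 <= n)%N]) (ifs_prefix w n @` X) = [set x]].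

Definition full_dimension_spectrum (A : set I) : Prop :=
  forall t : R, 0 <= t -> (t%:E <= hausdorff_dim (limit_set A))%E ->
    exists2 D : set I, D `<=` A & hausdorff_dim (limit_set D) = t%:E.

End IteratedFunctionSystem.

Section NearestIntegerContinuedFraction.
Context {R : realType}.
Implicit Types (b e : int) (tau : seq int) (x : R).

Definition Xv : set R := [set` `[- 2^-1, 2^-1]].

(* Extended to all of [R]; the restriction of [phi b] to [phi_dom b] is the
   actual map, and [phi_word_dom] below shows that evaluating a word of the
   alphabet on [Xv] only ever applies [phi b] inside [phi_dom b]. *)
Definition phi b x : R := (b%:~R + x)^-1.

Definition phi_dom b : set R :=
  if b == 2 then [set` `[0, 2^-1]]
  else if b == -2 then [set` `[- 2^-1, 0]]
  else Xv.

Definition phi_word tau : R -> R := \big[comp/id]_(b <- tau) phi b.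

Definition Ebar : set (seq int) :=
  [set [:: e] | e in [set e : int | 2 < `|e|]]
  `|` [set tau | exists n e, [/\ (1 <= n)%N, 2 < e & tau = rcons (nseq n 2) e]]
  `|` [set tau | exists n e, [/\ (1 <= n)%N, e < -2
                               & tau = rcons (nseq n (-2)) e]].

End NearestIntegerContinuedFraction.

Arguments Xv : clear implicits.

Section WellDefined.
Context {R : realType}.

Local Lemma phi_pos (b : int) (x : R) :
  2 <= b -> phi_dom b x -> 0 <= phi b x <= 2^-1.
Proof.
move=> b2 bx; have bx2 : 2 <= b%:~R + x.
  move: bx; rewrite /phi_dom /Xv; have [->|bN2] := eqVneq b 2.
    by rewrite /= in_itv /= => /andP[? _]; lra.
  rewrite ifF /= ?in_itv /=; last by apply/negbTE; lia.
  move=> /andP[? _]; have : (3%:~R : R) <= b%:~R by rewrite ler_int; lia.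
  by lra.
by rewrite /phi invr_ge0 lef_pV2 ?posrE; [apply/andP; split; lra|lra|lra].
Qed.

Local Lemma phiN (b : int) (x : R) : phi (- b) (- x) = - phi b x.
Proof. by rewrite /phi rmorphN -opprD invrN. Qed.

Local Lemma phi_domN (b : int) (x : R) : phi_dom b x -> phi_dom (- b) (- x).
Proof.
rewrite /phi_dom /Xv eqr_opp (_ : (- b == 2) = (b == - 2)); last by lia.
by case: eqVneq => [->|_]; [|case: ifP => _]; rewrite /= !in_itv /=; lra.
Qed.

Local Lemma phi_neg (b : int) (x : R) :
  b <= -2 -> phi_dom b x -> - 2^-1 <= phi b x <= 0.
Proof.
move=> b2 bx; have Nb2 : 2 <= - b by lia.
by have := phi_pos Nb2 (phi_domN bx); rewrite phiN; lra.
Qed.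

Local Lemma phi_word_cons (b : int) tau (x : R) :
  phi_word (b :: tau) x = phi b (phi_word tau x).
Proof. by rewrite /phi_word big_cons. Qed.

Local Lemma phi_word0 (x : R) : phi_word [::] x = x.
Proof. by rewrite /phi_word big_nil. Qed.

Local Lemma phi_word_pos n (e : int) (x : R) : 2 < e -> Xv R x ->
  0 <= phi_word (rcons (nseq n 2) e) x <= 2^-1.
Proof.
move=> e2 Xx; elim: n => [|n IHn]; rewrite /= phi_word_cons.
  apply: phi_pos; rewrite ?phi_word0; first by lia.
  by rewrite /phi_dom !ifF //; lia.
by apply: phi_pos => //; rewrite /phi_dom /= in_itv.
Qed.

Local Lemma phi_word_neg n (e : int) (x : R) : e < -2 -> Xv R x ->
  - 2^-1 <= phi_word (rcons (nseq n (-2)) e) x <= 0.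
Proof.
move=> e2 Xx; elim: n => [|n IHn]; rewrite /= phi_word_cons.
  apply: phi_neg; rewrite ?phi_word0; first by lia.
  by rewrite /phi_dom !ifF //; lia.
by apply: phi_neg => //; rewrite /phi_dom /= in_itv.
Qed.

Local Lemma EbarP tau : Ebar tau -> exists n (e : int),
  2 < e /\ tau = rcons (nseq n 2) e \/ e < -2 /\ tau = rcons (nseq n (-2)) e.
Proof.
case=> [[[e /= e2 <-]|[n [e [_ e2 ->]]]]|[n [e [_ e2 ->]]]].
- exists 0, e => /=.
  have [e_gt|e_lt] : 2 < e \/ e < -2 by lia.
    by left.
  by right.
- by exists n, e; left.
- by exists n, e; right.
Qed.

Local Lemma rcons_nseq_cat n (c e b : int) s1 s2 :
  rcons (nseq n c) e = s1 ++ b :: s2 ->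
  (b = e /\ s2 = [::]) \/ exists m, b = c /\ s2 = rcons (nseq m c) e.
Proof.
elim: n s1 => [|n IHn] [|a s1] /=.
- by case=> <- <-; left.
- by case=> _; case: s1.
- by case=> <- <-; right; exists n.
- by case=> _ /IHn.
Qed.

Lemma phi_word_stable tau (x : R) :
  Ebar tau -> Xv R x -> Xv R (phi_word tau x).
Proof.
move=> /EbarP[n [e [[e2 ->]|[e2 ->]]]] Xx; rewrite /Xv /= in_itv /=.
  by move: (phi_word_pos n e2 Xx); lra.
by move: (phi_word_neg n e2 Xx); lra.
Qed.

Lemma phi_word_dom tau s1 b s2 (x : R) :
  Ebar tau -> tau = s1 ++ b :: s2 -> Xv R x -> phi_dom b (phi_word s2 x).
Proof.
move=> /EbarP[n [e [[e2 ->]|[e2 ->]]]].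
- move=> /rcons_nseq_cat[[-> ->]|[m [-> ->]]] Xx.
    by rewrite phi_word0 /phi_dom !ifF //; lia.
  by rewrite /phi_dom /= in_itv /=; apply: phi_word_pos.
- move=> /rcons_nseq_cat[[-> ->]|[m [-> ->]]] Xx.
    by rewrite phi_word0 /phi_dom !ifF //; lia.
  by rewrite /phi_dom /= in_itv /=; apply: phi_word_neg.
Qed.

End WellDefined.

(* Main.v *)
Require Import Defs.
From mathcomp Require Import all_boot all_order all_algebra.
From mathcomp Require Import all_classical all_reals all_analysis.
From mathcomp Require Import zify ring lra.

(* The derivative of [phi_word] along a word has the form
   [(c / (1 + r x)) ^ 2] with [|r| <= 1 / 2], because the maps are Moebius and
   the quotient of consecutive denominators stays in [[-1/2, 1/2]].  This gives
   bounded distortion with constant 3, hence a Bowen-type criterion: [dim J_D] is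
   at most [s] as soon as the sums over words of length [n] of the [s]-th powers
   of the derivatives are bounded uniformly in [n] and in the finite subsystem
   of [D], and conversely [dim J_D < s] forces them to be at most [9 ^ s].

   Adding the letter [2^n e] to a finite system costs at most as much as adding
   the five letters [2^n (e + 1), ..., 2^n (e + 5)]: with [a = e + x + r >= 2] and
   [s <= 1], this is [a ^ (-2 s) <= sum_(1 <= i <= 5) (a + i) ^ (-2 s)].

   Enumerate the alphabet so that these five letters come after [2^n e], and
   accept a letter whenever the dimension stays at most [t].  If the resulting
   [D] had dimension less than [t], all letters with small derivative would be
   accepted, so there would be a last rejected letter (unless [D] is the whole
   alphabet).  The five letters dominating it belong to [D], so adding it to the
   letters accepted before it would not have pushed the dimension above [t]. *)

Set Implicit Arguments.
Unset Strict Implicit.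
Unset Printing Implicit Defensive.

Import Order.TTheory GRing.Theory Num.Theory.

Local Open Scope classical_set_scope.
Local Open Scope ring_scope.

(** * The letters of the alphabet and their derivatives *)

Section Letters.

(** The sign bit [b], the run length [n] and the offset [j] parametrize all three families of [Ebar]
    at once; [n = 0] gives the one-letter words. *)
Definition letter (b : bool) (n j : nat) : seq int :=
  rcons (nseq n ((-1) ^+ b * 2)) ((-1) ^+ b * (j + 3)%:Z).

Lemma Ebar_letter b n j : Ebar (letter b n j).
Proof.
rewrite /letter /Ebar; case: n => [|n].
  left; left; rewrite /=; exists ((-1) ^+ b * (j + 3)%:Z) => //=.
  by rewrite normrM normrX normrN1 expr1n; lia.
case: b; rewrite ?expr0 ?expr1.
  by right; exists n.+1, (-1 * (j + 3)%:Z); split=> //; lia.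
by left; right; exists n.+1, (1 * (j + 3)%:Z); split=> //; lia.
Qed.

Lemma EbarP tau : Ebar tau <-> exists b n j, tau = letter b n j.
Proof.
split=> [|[b [n [j ->]]]]; last exact: Ebar_letter.
move=> /Defs.EbarP[n [e [[e2 ->]|[e2 ->]]]].
  exists false, n, (absz (e - 3)); rewrite /letter expr0 !mul1r; congr rcons; lia.
exists true, n, (absz (e + 3)); rewrite /letter expr1; congr rcons; lia.
Qed.

Lemma letter_inj b n j b' n' j' :
  letter b n j = letter b' n' j' -> [/\ b = b', n = n' & j = j'].
Proof.
move=> E.
have n_eq : n = n'.
  by move/(congr1 size): E; rewrite /letter !size_rcons !size_nseq => -[].
move/(congr1 (last 0)): E; rewrite /letter !last_rcons.
by case: b; case: b'; rewrite ?expr0 ?expr1 => e_eq; split => //; lia.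
Qed.

End Letters.

Section Scale.
Context {R : realType}.
Implicit Types (tau : seq int) (x y : R).

(* The square root of [`|phi_word tau ^`() x|]. *)
Fixpoint scale tau x : R :=
  if tau is b :: s then `|b%:~R + phi_word s x|^-1 * scale s x else 1.

Lemma phi_word_cat s1 s2 x : phi_word (s1 ++ s2) x = phi_word s1 (phi_word s2 x).
Proof.
elim: s1 => [|b s1 IH] /=; first by rewrite Defs.phi_word0.
by rewrite !Defs.phi_word_cons IH.
Qed.

Lemma scale_cat s1 s2 x :
  scale (s1 ++ s2) x = scale s1 (phi_word s2 x) * scale s2 x.
Proof.
elim: s1 => [|b s1 IH] /=; first by rewrite mul1r.
by rewrite IH phi_word_cat mulrA.
Qed.

Lemma XvE x : Xv R x <-> `|x| <= 2^-1.
Proof. by rewrite /Xv /= in_itv /= ler_norml. Qed.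

Lemma norm0_le_half : `|0 : R| <= 2^-1.
Proof. by rewrite normr0 invr_ge0. Qed.

(** Each map is applied inside its [phi_dom]: behind [2] or [-2] the inner value does not have the
    opposite sign, and otherwise the letter has modulus at least [3] and the inner value at most
    [1/2]. The decomposition of [tau] allows induction on its suffixes. *)
Lemma Ebar_suffix tau : Ebar tau -> forall s1 b s2 x, tau = s1 ++ b :: s2 ->
  `|x| <= 2^-1 -> 2 <= `|b%:~R + phi_word s2 x|.
Proof.
move=> Et s1 b s2 x E /XvE Xx; have := phi_word_dom Et E Xx.
have b2 : (2 <= b) || (b <= -2).
  have : b \in tau by rewrite E mem_cat inE eqxx orbT.
  case/Defs.EbarP: Et => n [e [[e2 ->]|[e2 ->]]];
    rewrite mem_rcons inE mem_nseq => /orP[/eqP->|/andP[_ /eqP->]] //; lia.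
rewrite /phi_dom /Xv; have [->|bn2] := eqVneq b 2.
  by rewrite /= in_itv /= => ?; rewrite ger0_norm; lra.
have [->|bnN2] := eqVneq b (-2).
  by rewrite /= in_itv /= => ?; rewrite ler0_norm; lra.
rewrite /= in_itv /= => ?; case/orP: b2 => b2.
  have : (3%:~R : R) <= b%:~R by rewrite ler_int; lia.
  by move=> ?; rewrite ger0_norm; lra.
have : (b%:~R : R) <= (-3)%:~R by rewrite ler_int; lia.
by move=> ?; rewrite ler0_norm; lra.
Qed.

Lemma scale_le tau x : Ebar tau -> `|x| <= 2^-1 ->
  0 < scale tau x <= 2^-1 ^+ size tau.
Proof.
move=> Et Xx.
suff H s1 s2 : tau = s1 ++ s2 -> 0 < scale s2 x <= 2^-1 ^+ size s2 by exact: (H [::]).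
elim: s2 s1 => [|b s2 IH] s1 E /=; first by rewrite expr0 ltr01 lexx.
have /andP[s_gt0 s_le] : 0 < scale s2 x <= 2^-1 ^+ size s2.
  by apply: (IH (rcons s1 b)); rewrite E -cats1 -catA.
have b2 := Ebar_suffix Et E Xx.
apply/andP; split; first by rewrite mulr_gt0 // invr_gt0; lra.
rewrite exprS ler_pM ?invr_ge0 ?(ltW s_gt0) //.
by rewrite lef_pV2 // posrE; lra.
Qed.

Lemma scale_dist tau x y : Ebar tau -> `|x| <= 2^-1 -> `|y| <= 2^-1 ->
  `|phi_word tau x - phi_word tau y| = scale tau x * scale tau y * `|x - y|.
Proof.
move=> Et Xx Xy.
suff H s1 s2 : tau = s1 ++ s2 ->
    `|phi_word s2 x - phi_word s2 y| = scale s2 x * scale s2 y * `|x - y|.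
  exact: (H [::]).
elim: s2 s1 => [|b s2 IH] s1 E /=; first by rewrite !Defs.phi_word0 !mul1r.
rewrite !Defs.phi_word_cons /phi.
have := Ebar_suffix Et E Xx; have := Ebar_suffix Et E Xy.
have : `|phi_word s2 x - phi_word s2 y| = scale s2 x * scale s2 y * `|x - y|.
  by apply: (IH (rcons s1 b)); rewrite E -cats1 -catA.
set u := phi_word s2 x; set v := phi_word s2 y => uv v2 u2.
have u0 : b%:~R + u != 0 by rewrite -normr_gt0; lra.
have v0 : b%:~R + v != 0 by rewrite -normr_gt0; lra.
have -> : (b%:~R + u)^-1 - (b%:~R + v)^-1
    = (v - u) * ((b%:~R + u)^-1 * (b%:~R + v)^-1) by field; rewrite u0 v0.
by rewrite !normrM !normfV distrC uv; ring.
Qed.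

Lemma phi_wordN tau x : phi_word [seq - b | b <- tau] (- x) = - phi_word tau x.
Proof.
elim: tau => [|b s IH] /=; first by rewrite !Defs.phi_word0.
by rewrite !Defs.phi_word_cons IH Defs.phiN.
Qed.

Lemma scaleN tau x : scale [seq - b | b <- tau] (- x) = scale tau x.
Proof.
elim: tau => [|b s IH] //=.
by rewrite IH phi_wordN rmorphN -opprD normrN.
Qed.

Lemma letterN n j : letter true n j = [seq - b | b <- letter false n j].
Proof. by rewrite /letter map_rcons map_nseq expr0 expr1 !mul1r !mulN1r. Qed.

Lemma letterS n j : letter false n.+1 j = 2 :: letter false n j.
Proof. by rewrite /letter /= expr0 mul1r. Qed.

Lemma letter0 j : letter false 0 j = [:: (j + 3)%:Z].
Proof. by rewrite /letter /= expr0 mul1r. Qed.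

(** The lower bound for [n] gives the upper bound for [n.+1] through [1 / (2 + y)]. What matters
    later is that the image stays away from [1/2]. *)
Lemma letter_ge0 n j x : `|x| <= 2^-1 ->
  (j + 4)%:R^-1 <= phi_word (letter false n j) x <= 2^-1 - (6 * (j + 4))%:R^-1.
Proof.
move=> Xx; have j0 : 0 <= j%:R :> R := ler0n _ _.
rewrite natrM !natrD; elim: n => [|n IH].
  rewrite letter0 Defs.phi_word_cons Defs.phi_word0 /phi -pmulrn natrD.
  move: Xx; rewrite ler_norml => /andP[x1 x2].
  apply/andP; split; first by rewrite lef_pV2 ?posrE; lra.
  apply: (@le_trans _ _ (5/2)^-1); first by rewrite lef_pV2 ?posrE; lra.
  have : ((6 * (j%:R + 4))^-1 : R) <= 24^-1 by rewrite lef_pV2 ?posrE; lra.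
  by lra.
rewrite letterS Defs.phi_word_cons /phi.
move: IH; set y := phi_word _ x => /andP[y1 y2].
have j1 : 0 < (j%:R + 4)^-1 :> R by rewrite invr_gt0; lra.
have j2 : 0 < (6 * (j%:R + 4))^-1 :> R by rewrite invr_gt0; lra.
apply/andP; split; first by rewrite lef_pV2 ?posrE; lra.
apply: (@le_trans _ _ (2 + (j%:R + 4)^-1)^-1); first by rewrite lef_pV2 ?posrE; lra.
rewrite -subr_ge0.
have -> : 2^-1 - (6 * (j%:R + 4))^-1 - (2 + (j%:R + 4)^-1)^-1
   = (j%:R + 3) * ((6 * (j%:R + 4)) * (2 * j%:R + 9))^-1 :> R.
  by field; rewrite !gt_eqF //; lra.
by rewrite mulr_ge0 ?invr_ge0 ?mulr_ge0; lra.
Qed.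

(** Images of [Xv] under distinct letters can touch, as in [1 / (3 + 1/2) = 1 / (4 - 1/2)]. A finite
    system is therefore restricted to a smaller interval [[-h, h]], on which its letters are
    separated. *)
Lemma letter_shrink tau : Ebar tau ->
  exists2 h : R, 0 <= h < 2^-1 &
    forall x, `|x| <= 2^-1 -> `|phi_word tau x| <= h.
Proof.
case/EbarP=> b [n [j ->]].
exists (2^-1 - (6 * (j + 4))%:R^-1) => [|x Xx].
  have -> : (6 * (j + 4))%:R = 6 * (j%:R + 4) :> R by rewrite natrM natrD.
  have j0 : 0 <= j%:R :> R := ler0n _ _.
  have : ((6 * (j%:R + 4))^-1 : R) <= 24^-1 by rewrite lef_pV2 ?posrE; lra.
  have : 0 < (6 * (j%:R + 4))^-1 :> R by rewrite invr_gt0; lra.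
  by lra.
wlog -> : b x Xx / b = false => [H|].
  case: b; last exact: H.
  rewrite letterN -[x]opprK phi_wordN normrN.
  by apply: (H false) => //; rewrite normrN.
have /andP[l1 l2] := letter_ge0 n j Xx.
by rewrite ger0_norm // (le_trans _ l1) // invr_ge0.
Qed.

End Scale.

(** * Words over the alphabet: contraction, distortion and domination *)

Section Words.
Context {R : realType}.
Implicit Types (tau : seq int) (w : seq (seq int)) (x y : R).

Definition word_on (D : set (seq int)) w := forall tau, tau \in w -> D tau.

Lemma word_on_cons D tau w : word_on D (tau :: w) <-> D tau /\ word_on D w.
Proof.
split=> [H|[Dt Dw] k]; last by rewrite inE => /orP[/eqP->|/Dw].
by split=> [|k kw]; apply: H; rewrite inE ?eqxx // kw orbT.
Qed.

Lemma word_on_rcons D tau w : word_on D (rcons w tau) <-> D tau /\ word_on D w.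
Proof.
rewrite -word_on_cons.
by split=> H k kw; apply: H; move: kw; rewrite mem_rcons.
Qed.

Lemma word_stable w x : word_on Ebar w -> `|x| <= 2^-1 ->
  `|phi_word (flatten w) x| <= 2^-1.
Proof.
move=> + Xx; elim: w => [|tau w IH] /=; first by rewrite Defs.phi_word0.
move=> /word_on_cons[Et /IH Xw].
by rewrite phi_word_cat; apply/XvE/phi_word_stable => //; apply/XvE.
Qed.

Lemma word_scale_le w x : word_on Ebar w -> `|x| <= 2^-1 ->
  0 < scale (flatten w) x <= 2^-1 ^+ size w.
Proof.
move=> + Xx; elim: w => [|tau w IH] /=; first by rewrite expr0 ltr01 lexx.
move=> /word_on_cons[Et Ew]; have /andP[w1 w2] := IH Ew.
have /andP[t1 t2] := scale_le Et (word_stable Ew Xx).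
rewrite scale_cat mulr_gt0 //= exprS ler_pM ?(ltW w1) ?(ltW t1) //.
apply: le_trans t2 _; rewrite -[leRHS]expr1 ler_wiXn2l //; try lra.
by case/EbarP: Et => b [n [j ->]]; rewrite /letter size_rcons.
Qed.

Lemma word_scale_gt0 w x : word_on Ebar w -> `|x| <= 2^-1 ->
  0 < scale (flatten w) x.
Proof. by move=> Ew /(word_scale_le Ew)/andP[]. Qed.

Lemma word_dist w x y : word_on Ebar w -> `|x| <= 2^-1 -> `|y| <= 2^-1 ->
  `|phi_word (flatten w) x - phi_word (flatten w) y|
    = scale (flatten w) x * scale (flatten w) y * `|x - y|.
Proof.
move=> + Xx Xy; elim: w => [|tau w IH] /=.
  by rewrite !Defs.phi_word0 !mul1r.
move=> /word_on_cons[Et Ew]; rewrite !phi_word_cat !scale_cat.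
by rewrite scale_dist ?word_stable // IH //; ring.
Qed.

(* [c / (1 + r y)] with [|r| <= 1/2] is the shape of [scale] on words; after the
   letter [2] repeated [n] times, followed by [e > 2], it becomes
   [c' / (e + r' + x)] with [c'] and [r'] independent of [e]. *)
Lemma scale_letter_pos (n : nat) (c r : R) : 0 < c -> - 2^-1 <= r <= 1 ->
  exists c' r', [/\ 0 < c', - 2^-1 <= r' <= 1 & forall j x, `|x| <= 2^-1 ->
    c / (1 + r * phi_word (letter false n j) x) * scale (letter false n j) x
      = c' / (j%:R + 3 + r' + x)].
Proof.
elim: n c r => [|n IH] c r c0 /andP[r1 r2].
  exists c, r; split=> // [|j x]; first by lra.
  rewrite ler_norml => /andP[x1 x2]; have j0 : 0 <= j%:R :> R := ler0n _ _.
  rewrite letter0 /= Defs.phi_word_cons Defs.phi_word0 /phi -pmulrn natrD.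
  rewrite ger0_norm; last by lra.
  by field; rewrite !gt_eqF //; lra.
(* Passing the letter [2] uses [c / (1 + r / (2 + y)) / (2 + y) = (c / (2 + r)) / (1 + y / (2 +
   r))]. As [(2 + r)^-1] can exceed [1/2], the induction needs the range of [r] up to [1]. *)
have [] := IH (c / (2 + r)) (2 + r)^-1.
- by rewrite divr_gt0 //; lra.
- have : 0 < (2 + r)^-1 by rewrite invr_gt0; lra.
  have : (2 + r)^-1 <= 1 by rewrite invf_le1; lra.
  by lra.
move=> c' [r' [c'0 r'1 H]]; exists c', r'; split=> // j x Xx.
rewrite letterS /= Defs.phi_word_cons /phi -H //.
have /andP[y1 y2] := letter_ge0 n j Xx; move: y1 y2.
set y := phi_word _ x => y1 y2.
have {y1} y0 : 0 <= y by rewrite (le_trans _ y1) // invr_ge0.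
rewrite ger0_norm; last by lra.
by field; rewrite !gt_eqF //; nra.
Qed.

Lemma scale_letter (b : bool) (n : nat) (c r : R) : 0 < c -> `|r| <= 2^-1 ->
  exists c' r', [/\ 0 < c', - 2^-1 <= r' <= 1 & forall j x, `|x| <= 2^-1 ->
    c / (1 + r * phi_word (letter b n j) x) * scale (letter b n j) x
      = c' / (j%:R + 3 + r' + (-1) ^+ b * x)].
Proof.
rewrite ler_norml => c0 r12; case: b; last first.
  have [|c' [r' [c'0 r'1 H]]] := @scale_letter_pos n c r c0; first by lra.
  by exists c', r'; split=> // j x Xx; rewrite mul1r H.
have [|c' [r' [c'0 r'1 H]]] := @scale_letter_pos n c (- r) c0; first by lra.
exists c', r'; split=> // j x Xx.
rewrite -[x]opprK letterN phi_wordN scaleN mulrN -mulNr H ?normrN //.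
by rewrite expr1 mulN1r opprK.
Qed.

Lemma word_form w : word_on Ebar w -> exists c r : R,
  [/\ 0 < c, `|r| <= 2^-1 &
   forall x, `|x| <= 2^-1 -> scale (flatten w) x = c / (1 + r * x)].
Proof.
elim/last_ind: w => [|w tau IH].
  by move=> _; exists 1, 0; split=> [||x _]; rewrite ?normr0 //= mul0r addr0 divr1.
move=> /word_on_rcons[Et /[dup] Ew /IH[c [r [c0 r12 H]]]].
move: (Et) => /EbarP[b [n [j Ej]]].
have [c' [r' [c'0 r'1 H']]] := scale_letter b n c0 r12.
have j0 : 0 <= j%:R :> R := ler0n _ _.
(* Up to the sign of [x], [c' / (k + x) = (c' / k) / (1 + x / k)] with [k = j + 3 + r' >= 5/2], so
   the new [r] is again at most [1/2] in absolute value. *)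
have k0 : 0 < j%:R + 3 + r' by lra.
exists (c' / (j%:R + 3 + r')), ((-1) ^+ b / (j%:R + 3 + r')); split.
- by rewrite divr_gt0.
- rewrite normrM normrX normrN1 expr1n mul1r normfV gtr0_norm //.
  by rewrite lef_pV2 ?posrE; lra.
- move=> x Xx; rewrite flatten_rcons scale_cat H; last first.
    by apply/XvE/phi_word_stable => //; apply/XvE.
  rewrite Ej H' //; case: b {Ej H'}; move: Xx;
    rewrite ?expr0 ?expr1 ler_norml => ?; field; rewrite !gt_eqF //; lra.
Qed.

(** In [word_form] the denominator [1 + r x] lies between [3/4] and [5/4], so the ratio is in fact
    at most [5/3]. *)
Lemma word_distortion w x y : word_on Ebar w ->
  `|x| <= 2^-1 -> `|y| <= 2^-1 ->
  scale (flatten w) x <= 3 * scale (flatten w) y.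
Proof.
move=> /word_form[c [r [c0 r12 H]]] Xx Xy; rewrite !H //.
have b z : `|z| <= 2^-1 -> `|r * z| <= 4^-1.
  move=> Xz; rewrite normrM (_ : 4^-1 = 2^-1 * 2^-1); last by field.
  by rewrite ler_pM.
move: (b _ Xx) (b _ Xy); rewrite !ler_norml => /andP[x1 x2] /andP[y1 y2].
rewrite mulrCA ler_pM2l // ler_pdivlMr; last by lra.
by rewrite mulrC ler_pdivrMr; lra.
Qed.

Definition next_letters b n j := [seq letter b n (j + i) | i <- iota 1 5].

(** The worst case is [a = 2], [p = 2], where the five ratios [(2 / (2 + i)) ^ 2] sum to slightly
    more than [1]; four of them would not reach [1]. *)
Lemma powR_tail (a c p : R) : 2 <= a -> 0 < c -> 0 <= p <= 2 ->
  (c / a) `^ p <= \sum_(i <- iota 1 5) (c / (a + i%:R)) `^ p.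
Proof.
move=> a2 c0 /andP[p0 p2].
have a0 : 0 < a by lra.
have H i : (2 / (2 + i%:R)) ^+ 2 * (c / a) `^ p <= (c / (a + i%:R)) `^ p.
  have i0 : 0 <= i%:R :> R := ler0n _ _.
  have -> : c / (a + i%:R) = (a / (a + i%:R)) * (c / a).
    by field; rewrite !gt_eqF //; lra.
  have q0 : 0 < a / (a + i%:R) by rewrite divr_gt0 //; lra.
  have q1 : a / (a + i%:R) <= 1 by rewrite ler_pdivrMr; lra.
  have q2 : 2 / (2 + i%:R) <= a / (a + i%:R).
    by rewrite ler_pdivrMr; [rewrite mulrAC ler_pdivlMr; nra|lra].
  rewrite (@powRM _ (a / (a + i%:R))) ?(ltW q0) ?divr_ge0 ?(ltW c0) ?(ltW a0) //.
  apply: ler_wpM2r; first exact: powR_ge0.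
  apply: (@le_trans _ _ ((a / (a + i%:R)) `^ 2)).
    rewrite powR_mulrn ?(ltW q0) //.
    by rewrite ler_sqr ?nnegrE ?(ltW q0) // divr_ge0 //; lra.
  by apply: ger_powR => //; rewrite q0 q1.
apply: (@le_trans _ _ (\sum_(i <- iota 1 5) (2 / (2 + i%:R)) ^+ 2 * (c / a) `^ p)).
  rewrite -mulr_suml ler_peMl ?powR_ge0 //.
  rewrite /= !big_cons big_nil.
  have -> : (2 / (2 + 1)) ^+ 2 = 4 / 9 :> R by field.
  have -> : (2 / (2 + 2)) ^+ 2 = 1 / 4 :> R by field.
  have -> : (2 / (2 + 3)) ^+ 2 = 4 / 25 :> R by field.
  have -> : (2 / (2 + 4)) ^+ 2 = 1 / 9 :> R by field.
  have -> : (2 / (2 + 5)) ^+ 2 = 4 / 49 :> R by field.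
  by lra.
by apply: ler_sum => i _; exact: H.
Qed.

(** By [scale_letter] the scales are [c' / (a + i)], with [i = 0] for the letter itself, where [c']
    and [r'] are common to all six letters and [a = j + 3 + r' + x], up to the sign of [x], is at
    least [3 - 1/2 - 1/2 = 2]. *)
Lemma next_letters_dominate w b n j (s : R) x : word_on Ebar w ->
  0 <= s <= 1 -> `|x| <= 2^-1 ->
  scale (flatten (rcons w (letter b n j))) x `^ (2 * s) <=
  \sum_(tau <- next_letters b n j) scale (flatten (rcons w tau)) x `^ (2 * s).
Proof.
move=> Ew s01 Xx; have [c [r [c0 r12 H]]] := word_form Ew.
have [c' [r' [c'0 r'1 H']]] := scale_letter b n c0 r12.
have E i : scale (flatten (rcons w (letter b n i))) x
    = c' / (i%:R + 3 + r' + (-1) ^+ b * x).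
  rewrite flatten_rcons scale_cat H ?H' //.
  by apply/XvE/phi_word_stable; [exact: Ebar_letter|exact/XvE].
rewrite /next_letters big_map E.
have D i : j%:R + i%:R + 3 + r' + (-1) ^+ b * x
    = j%:R + 3 + r' + (-1) ^+ b * x + i%:R :> R by ring.
under eq_bigr => i _ do rewrite E natrD D.
apply: powR_tail => //; last by lra.
have j0 : 0 <= j%:R :> R := ler0n _ _.
have : - 2^-1 <= (-1) ^+ b * x.
  by move: Xx; rewrite ler_norml; case: b {E H' D}; rewrite ?expr0 ?expr1; lra.
by lra.
Qed.

End Words.

(** * Partition functions *)

Section PartitionFunction.
Context {R : realType}.
Implicit Types (tau : seq int) (F : seq (seq int)) (w : seq (seq int)).
Implicit Types (s t x y : R).

Lemma sum_uniq_subset (T : eqType) (A B : seq T) (f : T -> R) : uniq A ->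
  {subset A <= B} -> (forall i, i \in B -> 0 <= f i) ->
  \sum_(i <- A) f i <= \sum_(i <- B) f i.
Proof.
elim: A B => [|a A IH] B /=.
  by move=> _ _ f0; rewrite big_nil big_seq sumr_ge0.
move=> /andP[aA uA] AB f0; have aB : a \in B by rewrite AB ?inE ?eqxx.
rewrite (perm_big _ (perm_to_rem aB)) /= !big_cons lerD2l; apply: IH => //.
  move=> i iA; have := AB i; rewrite inE iA orbT => /(_ isT).
  rewrite (perm_mem (perm_to_rem aB)) inE => /orP[/eqP ia|//].
  by rewrite -ia iA in aA.
by move=> i /mem_rem /f0.
Qed.

Fixpoint words F n : seq (seq (seq int)) :=
  if n is m.+1 then [seq rcons w tau | tau <- F, w <- words F m] else [:: [::]].

Lemma mem_words F n w :
  (w \in words F n) = (size w == n) && all (fun tau => tau \in F) w.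
Proof.
elim: n w => [|n IH] w /=; first by case: w.
elim/last_ind: w => [|w tau _].
  by apply/negbTE/allpairsP => -[[k v] /= [_ _]]; case: v.
rewrite size_rcons eqSS all_rcons; apply/allpairsP/idP => [[[k v] /=]|].
  by rewrite IH => -[kF /andP[nv Fv] /rcons_inj[-> ->]]; rewrite nv kF.
by move=> /and3P[nw kF Fw]; exists (tau, w); rewrite /= IH nw Fw.
Qed.

Lemma uniq_words F n : uniq F -> uniq (words F n).
Proof.
move=> uF; elim: n => [|n IH] //=.
apply: allpairs_uniq => // -[k v] [k' v'] _ _ /= /rcons_inj[-> ->] //.
Qed.

Lemma words_on (D : set (seq int)) F n w :
  word_on D F -> w \in words F n -> word_on D w.
Proof.
by move=> DF; rewrite mem_words => /andP[_ /allP wF] tau /wF /DF.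
Qed.

Lemma words_size F n w : w \in words F n -> size w = n.
Proof. by rewrite mem_words => /andP[/eqP]. Qed.

(* [scale] is a square root of the derivative, hence the exponent [2 * s]. *)
Definition Zsum F s n x : R :=
  \sum_(w <- words F n) scale (flatten w) x `^ (2 * s).

Lemma scale_ge0 tau x : 0 <= scale tau x.
Proof. by elim: tau => [|b tau IH] //=; rewrite mulr_ge0 // invr_ge0. Qed.

Lemma Zsum_ge0 F s n x : 0 <= Zsum F s n x.
Proof. by apply: sumr_ge0 => w _; exact: powR_ge0. Qed.

Lemma Zsum0 F s x : Zsum F s 0 x = 1.
Proof. by rewrite /Zsum big_seq1 powR1. Qed.

Lemma scale_mul_Zsum F s n tau x :
  scale tau x `^ (2 * s) * Zsum F s n (phi_word tau x)
    = \sum_(w <- words F n) scale (flatten (rcons w tau)) x `^ (2 * s).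
Proof.
rewrite mulr_sumr; apply: eq_bigr => w _.
by rewrite flatten_rcons scale_cat powRM ?scale_ge0 // mulrC.
Qed.

(** [Zsum F s n] is the [n]-th iterate of the transfer operator of [F] on the constant [1]. Words
    are extended at the end, where the map acting first stands, to obtain this recursion. *)
Lemma ZsumS F s n x : Zsum F s n.+1 x
  = \sum_(tau <- F) scale tau x `^ (2 * s) * Zsum F s n (phi_word tau x).
Proof.
rewrite /Zsum /= big_allpairs_dep /=.
by apply: eq_bigr => tau _; rewrite -/(Zsum _ _ _ _) scale_mul_Zsum.
Qed.

Lemma Zsum_subset F G s n x : uniq F -> {subset F <= G} ->
  Zsum F s n x <= Zsum G s n x.
Proof.
move=> uF FG; apply: sum_uniq_subset; first exact: uniq_words.
- move=> w; rewrite !mem_words => /andP[-> /allP Fw] /=.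
  by apply/allP => tau /Fw /FG.
- by move=> w _; exact: powR_ge0.
Qed.

Lemma letter_stable tau x : Ebar tau -> `|x| <= 2^-1 ->
  `|phi_word tau x| <= 2^-1.
Proof. by move=> Et /XvE Xx; apply/XvE/phi_word_stable. Qed.

(** The transfer operator [L] is positive, so [1 <= u] and [L u <= u] give [L^n 1 <= L^n u <= u]. *)
Lemma Zsum_supersolution F s (u : R -> R) : word_on Ebar F ->
  (forall x, `|x| <= 2^-1 -> 1 <= u x) ->
  (forall x, `|x| <= 2^-1 ->
     \sum_(tau <- F) scale tau x `^ (2 * s) * u (phi_word tau x) <= u x) ->
  forall n x, `|x| <= 2^-1 -> Zsum F s n x <= u x.
Proof.
move=> EF u1 Lu; elim=> [|n IH] x Xx; first by rewrite Zsum0 u1.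
rewrite ZsumS; apply: le_trans (Lu x Xx).
rewrite big_seq [leRHS]big_seq; apply: ler_sum => tau tF.
by rewrite ler_wpM2l ?powR_ge0 // IH // letter_stable //; apply: EF.
Qed.

Lemma Zsum_replace F b m j s n x : word_on Ebar F -> 0 <= s <= 1 ->
  `|x| <= 2^-1 ->
  Zsum (letter b m j :: F) s n x <= Zsum (next_letters b m j ++ F) s n x.
Proof.
move=> EF s01.
have EN tau : tau \in next_letters b m j -> Ebar tau.
  by move=> /mapP[i _ ->]; exact: Ebar_letter.
have ENF : word_on Ebar (next_letters b m j ++ F).
  by move=> tau; rewrite mem_cat => /orP[/EN|/EF].
elim: n x => [|n IH] x Xx; first by rewrite !Zsum0.
rewrite !ZsumS big_cons big_cat /=; apply: lerD; last first.
  rewrite big_seq [leRHS]big_seq; apply: ler_sum => tau tF.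
  by rewrite ler_wpM2l ?powR_ge0 // IH // letter_stable //; apply: EF.
(* The induction hypothesis replaces the letter in the first [n] positions; then, for each fixed
   [w], the letter in last position is replaced by the five that dominate it. *)
apply: (@le_trans _ _ (scale (letter b m j) x `^ (2 * s)
    * Zsum (next_letters b m j ++ F) s n (phi_word (letter b m j) x))).
  by rewrite ler_wpM2l ?powR_ge0 // IH // letter_stable //; exact: Ebar_letter.
rewrite scale_mul_Zsum.
under [leRHS]eq_bigr => tau _ do rewrite scale_mul_Zsum.
rewrite exchange_big /= big_seq [leRHS]big_seq; apply: ler_sum => w wF.
by apply: next_letters_dominate => //; exact: words_on wF.
Qed.

(** A word of length [n] has scale at most [2 ^ (- n)], which bounds the extra factor of exponent
    [2 * (t - s)]. *)
Lemma Zsum_decay F s t n x : word_on Ebar F -> s <= t -> `|x| <= 2^-1 ->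
  Zsum F t n x <= (2^-1 `^ (2 * (t - s))) ^+ n * Zsum F s n x.
Proof.
move=> EF st Xx; rewrite /Zsum mulr_sumr big_seq [leRHS]big_seq.
apply: ler_sum => w wF.
have Ew := words_on EF wF.
have /andP[w0 w1] := word_scale_le Ew Xx; rewrite (words_size wF) in w1.
have -> : 2 * t = 2 * (t - s) + 2 * s by ring.
rewrite powRD; last by rewrite (gt_eqF w0) implybT.
rewrite ler_wpM2r ?powR_ge0 //.
rewrite -powR_mulrn ?powR_ge0 // powRAC powR_mulrn ?invr_ge0 //.
apply: ge0_ler_powR => //; rewrite ?nnegrE ?exprn_ge0 ?(ltW w0) ?invr_ge0 //.
by rewrite mulr_ge0 // subr_ge0.
Qed.

Lemma Zsum_le_exponent F s t n x : word_on Ebar F -> s <= t -> `|x| <= 2^-1 ->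
  Zsum F t n x <= Zsum F s n x.
Proof.
move=> EF st Xx; apply: le_trans (Zsum_decay _ EF st Xx) _.
rewrite ler_piMl ?Zsum_ge0 // exprn_ile1 ?powR_ge0 //.
rewrite -[leRHS](powRr0 2^-1); apply: ger_powR; first by lra.
by rewrite mulr_ge0 // subr_ge0.
Qed.

Lemma half_powR_itv s t : s < t -> 0 <= (2^-1 : R) `^ (2 * (t - s)) < 1.
Proof.
move=> st; rewrite powR_ge0 /= [ltRHS](_ : 1 = 1 `^ (2 * (t - s))); last by rewrite powR1.
by apply: gt0_ltr_powR; rewrite ?nnegrE; lra.
Qed.

Lemma geometric_small (K q e : R) : 0 <= q < 1 -> 0 < e -> exists N, K * q ^+ N <= e.
Proof.
move=> /andP[q0 q1] e0.
have [N _ /(_ N (leqnn N))] : \forall n \near \oo, K * q ^+ n < e.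
  have qn : `|q| < 1 by rewrite ger0_norm.
  have /cvgrPdist_lt/(_ e e0) := cvg_geometric K qn.
  apply: filterS => n; rewrite sub0r normrN; apply: le_lt_trans; exact: ler_norm.
by move=> /ltW; exists N.
Qed.

(* With [u := Zsum F t 0 + ... + Zsum F t N] and [L] the transfer operator of
   [F], [L u = u - 1 + Zsum F t N.+1 <= u - 1 / 2]; a letter with small
   derivative contributes at most [1 / 2] more. *)
Lemma Zsum_add_small (s t K : R) : s < t -> 0 < K ->
  exists2 e : R, 0 < e & exists M : R,
  forall F tau, word_on Ebar F -> Ebar tau ->
  (forall n x, `|x| <= 2^-1 -> Zsum F s n x <= K) ->
  (forall x, `|x| <= 2^-1 -> scale tau x `^ (2 * t) <= e) ->
  forall n x, `|x| <= 2^-1 -> Zsum (tau :: F) t n x <= M.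
Proof.
move=> st K0; set q := 2^-1 `^ (2 * (t - s)) : R.
have q01 : 0 <= q < 1 := half_powR_itv st.
have [N qN] := geometric_small K q01 (ltac:(by rewrite invr_gt0) : 0 < 2^-1 :> R).
have M0 : 0 < K * N.+1%:R by rewrite mulr_gt0.
(* The function [u] below is at most [K * N.+1], so a letter of weight at most this number
   contributes at most [1 / 2]. *)
exists (2^-1 / (K * N.+1%:R)); first by rewrite divr_gt0.
exists (K * N.+1%:R) => F tau EF Et ZK te n x Xx.
pose u x := \sum_(i < N.+1) Zsum F t i x.
have u_le y : `|y| <= 2^-1 -> u y <= K * N.+1%:R.
  move=> Xy; rewrite mulr_natr -[X in _ *+ X](card_ord N.+1) -sumr_const.
  apply: ler_sum => i _; apply: le_trans (ZK i y Xy).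
  by apply: Zsum_le_exponent => //; exact: ltW.
apply: le_trans (u_le x Xx).
apply: Zsum_supersolution => // {n x Xx}.
- by move=> k; rewrite inE => /orP[/eqP->//|/EF].
- move=> x Xx; rewrite /u big_ord_recl Zsum0 lerDl sumr_ge0 // => i _.
  exact: Zsum_ge0.
move=> x Xx; rewrite big_cons.
have -> : \sum_(k <- F) scale k x `^ (2 * t) * u (phi_word k x)
    = u x - 1 + Zsum F t N.+1 x.
  under eq_bigr => k _ do rewrite mulr_sumr.
  rewrite exchange_big /=.
  under eq_bigr => i _ do rewrite -ZsumS.
  rewrite big_ord_recr /u [in RHS]big_ord_recl Zsum0 /=.
  by rewrite [1 + _]addrC addrK.
have : scale tau x `^ (2 * t) * u (phi_word tau x) <= 2^-1.
  apply: (@le_trans _ _ (2^-1 / (K * N.+1%:R) * (K * N.+1%:R))).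
    apply: ler_pM; rewrite ?powR_ge0 ?te //.
      by apply: sumr_ge0 => i _; exact: Zsum_ge0.
    by apply: u_le; exact: letter_stable.
  by rewrite divfK // gt_eqF.
have : Zsum F t N.+1 x <= 2^-1.
  apply: le_trans (Zsum_decay _ EF (ltW st) Xx) _.
  apply: (@le_trans _ _ (q ^+ N.+1 * K)).
    by rewrite ler_wpM2l ?ZK // exprn_ge0 //; case/andP: q01.
  apply: le_trans qN; rewrite mulrC ler_wpM2l ?(ltW K0) //.
  by case/andP: q01 => ? /ltW ?; rewrite ler_wiXn2l.
by lra.
Qed.

End PartitionFunction.

(** * Hausdorff dimension *)

Section HausdorffDimension.
Context {R : realType}.
Implicit Types (A B U : set R) (s t : R).

Lemma hausdorff_weight_ge0 s U : (0 <= hausdorff_weight s U)%E.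
Proof. by rewrite /hausdorff_weight; case: ifP => // _; exact: poweR_ge0. Qed.

Lemma diam_le U (d : R) :
  (forall x y, U x -> U y -> `|x - y| <= d) -> (diam U <= d%:E)%E.
Proof.
by move=> Ud; apply: ge_ereal_sup => _ [[x y] /= [Ux Uy] <-]; rewrite lee_fin Ud.
Qed.

Lemma diam_ge U x y : U x -> U y -> (`|x - y|%:E <= diam U)%E.
Proof. by move=> Ux Uy; apply: ereal_sup_ubound; exists (x, y). Qed.

Lemma hausdorff_weight_le s U (d : R) : 0 <= s -> 0 <= d ->
  (forall x y, U x -> U y -> `|x - y| <= d) ->
  (hausdorff_weight s U <= if U == set0 then 0 else (d `^ s)%:E)%E.
Proof.
move=> s0 d0 Ud; rewrite /hausdorff_weight; case: ifPn => // /set0P[x Ux].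
have dU0 : (0 <= diam U)%E.
  by apply: le_trans (diam_ge Ux Ux); rewrite lee_fin.
rewrite -poweR_EFin; apply: gt0_ler_poweR => //; last exact: diam_le.
- by rewrite in_itv /= dU0 leey.
- by rewrite in_itv /= lee_fin d0 leey.
Qed.

(** Fine covers with arbitrarily small [t]-sums make the [t]-dimensional measure vanish for every
    [t > s]. The numbers [d i] need only bound the diameters, and finite partial sums suffice. *)
Lemma hausdorff_dim_le A s : 0 <= s ->
  (forall t, s < t -> forall delta e : R, 0 < delta -> 0 < e ->
    exists F : nat -> set R, exists d : nat -> R,
    [/\ A `<=` \bigcup_i F i,
        forall i, 0 <= d i <= delta,
        forall i x y, F i x -> F i y -> `|x - y| <= d i &
        forall N, \sum_(i < N | F i != set0) d i `^ t <= e]) ->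
  (hausdorff_dim A <= s%:E)%E.
Proof.
move=> s0 H; apply/lee_addgt0Pr => e e0.
apply: ereal_inf_lbound; exists (s + e) => //; split; first by lra.
have t0 : 0 <= s + e by lra.
apply/eqP; rewrite eq_le; apply/andP; split; last first.
  apply: (@le_trans _ _ (hausdorff_premeasure (s + e) 1 A)).
    apply: le_ereal_inf_tmp => _ [F _ <-].
    by apply: nneseries_ge0 => *; exact: hausdorff_weight_ge0.
  by apply: ereal_sup_ubound; exists 1 => //=; exact: ltr01.
apply: ge_ereal_sup => _ [delta /= delta0 <-].
apply/lee_addgt0Pr => e' e'0; rewrite add0e.
have st : s < s + e by lra.
have [F [d [AF d01 Fd sumF]]] := H (s + e) st delta e' delta0 e'0.
apply: ge_ereal_inf; eexists.
  exists F => //; split=> // i; apply: (@le_trans _ _ (d i)%:E).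
    by apply: diam_le => x y; exact: Fd.
  by rewrite lee_fin; case/andP: (d01 i).
apply: lime_le.
  by apply: is_cvg_nneseries => *; exact: hausdorff_weight_ge0.
apply: nearW => N.
apply: (@le_trans _ _ (\sum_(i < N) if F i == set0 then 0 else (d i `^ (s + e))%:E)%E).
  rewrite big_mkord; apply: lee_sum => i _; apply: hausdorff_weight_le => //.
    by case/andP: (d01 i).
  by move=> x y; exact: Fd.
apply: (@le_trans _ _ (\sum_(i < N | F i != set0) d i `^ (s + e))%:E); last first.
  by rewrite lee_fin.
rewrite -sumEFin [leRHS]big_mkcond /=; apply: lee_sum => i _.
by case: (F i == set0).
Qed.

Lemma hausdorff_dim_subset A B : A `<=` B ->
  (hausdorff_dim A <= hausdorff_dim B)%E.
Proof.
move=> AB; apply: ereal_inf_le_tmp => _ [s [s0 sB] <-]; exists s => //; split=> //.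
apply/eqP; rewrite eq_le; apply/andP; split; last first.
  apply: (@le_trans _ _ (hausdorff_premeasure s 1 A)).
    apply: le_ereal_inf_tmp => _ [F _ <-].
    by apply: nneseries_ge0 => *; exact: hausdorff_weight_ge0.
  by apply: ereal_sup_ubound; exists 1 => //=; exact: ltr01.
rewrite -sB; apply: ge_ereal_sup => _ [delta /= delta0 <-].
apply: (@le_trans _ _ (hausdorff_premeasure s delta B)); last first.
  by apply: ereal_sup_ubound; exists delta.
apply: ereal_inf_le_tmp => _ [F [BF Fd] <-]; exists F => //; split=> //.
exact: subset_trans BF.
Qed.

Lemma hausdorff_dim_ge0 A : (0 <= hausdorff_dim A)%E.
Proof. by apply: le_ereal_inf_tmp => _ [s [s0 _] <-]; rewrite lee_fin. Qed.

Lemma sum_half N : \sum_(i < N) 2^-1 ^+ i.+1 <= 1 :> R.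
Proof.
suff -> : \sum_(i < N) 2^-1 ^+ i.+1 = 1 - 2^-1 ^+ N :> R.
  by rewrite gerBl exprn_ge0 // invr_ge0.
elim: N => [|N IH]; first by rewrite big_ord0 expr0 subrr.
by rewrite big_ord_recr /= IH exprS; field.
Qed.

(** The covering sets are enlarged to open balls of positive radius, so that a finite subcover can
    be extracted later by compactness. *)
Lemma hausdorff_dim_lt_cover A s (e : R) : (hausdorff_dim A < s%:E)%E -> 0 < e ->
  exists c r : nat -> R, [/\ forall i, 0 < r i,
    forall x, A x -> exists i, `|x - c i| < r i &
    forall N, \sum_(i < N) r i `^ s <= e].
Proof.
move=> /ereal_inf_lt[_ [s0 [s00 As0] <-]]; rewrite lte_fin => s0s e0.
have s_gt0 : 0 < s by apply: le_lt_trans s0s.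
have e20 : 0 < e / 2 by rewrite divr_gt0.
(* Mesh [1] ensures that every diameter [d] is at most [1], so that its power decreases when the
   exponent grows from [s0] to [s]. *)
have : (hausdorff_premeasure s0 1 A < (e / 2)%:E)%E.
  apply: (@le_lt_trans _ _ 0%E); last by rewrite lte_fin.
  by rewrite -As0; apply: ereal_sup_ubound; exists 1 => //=; exact: ltr01.
move=> /ereal_inf_lt[_ [F [AF Fd] <-]] sumF.
have part N : (\sum_(0 <= i < N) hausdorff_weight s0 (F i) < (e / 2)%:E)%E.
  apply: le_lt_trans sumF; apply: nneseries_lim_ge => *.
  exact: hausdorff_weight_ge0.
have fin i : hausdorff_weight s0 (F i) \is a fin_num.
  rewrite ge0_fin_numE ?hausdorff_weight_ge0 //.
  apply: (@le_lt_trans _ _ (\sum_(0 <= j < i.+1) hausdorff_weight s0 (F j))%E).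
    rewrite big_nat_recr //=; apply: leeDr.
    by apply: sume_ge0 => *; exact: hausdorff_weight_ge0.
  by apply: lt_trans (part _) _; rewrite ltry.
pose v i := fine (hausdorff_weight s0 (F i)).
have v0 i : 0 <= v i by rewrite fine_ge0 // hausdorff_weight_ge0.
have q0 i : 0 < e / 2 * 2^-1 ^+ i.+1 by rewrite mulr_gt0 // exprn_gt0 // invr_gt0.
have vq0 i : 0 < v i + e / 2 * 2^-1 ^+ i.+1 by rewrite ltr_wpDl.
(* The geometric term makes the radius positive and strictly larger than the diameter of [F i], at a
   total cost of at most [e / 2]. *)
pose r i := (v i + e / 2 * 2^-1 ^+ i.+1) `^ s^-1.
have rs i : r i `^ s = v i + e / 2 * 2^-1 ^+ i.+1.
  by rewrite /r -powRrM mulVf ?gt_eqF // powRr1 // ltW.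
have r0 i : 0 < r i by rewrite powR_gt0.
(* The centre is a point of [F i], or the default [0] if [F i] is empty. *)
exists (fun i => xget 0 (F i)), r; split=> //.
- move=> x /AF[i _ Fx]; exists i.
  have Fc : F i (xget 0 (F i)) by apply: xgetPex; exists x.
  set c := xget 0 (F i) in Fc *.
  have dle : (`|x - c|%:E <= diam (F i))%E := diam_ge Fx Fc.
  have d0 : (0 <= diam (F i))%E by apply: le_trans dle; rewrite lee_fin.
  have dfin : diam (F i) \is a fin_num.
    by rewrite ge0_fin_numE //; apply: le_lt_trans (Fd i) _; rewrite ltry.
  have vE : v i = fine (diam (F i)) `^ s0.
    rewrite /v /hausdorff_weight ifF ?fine_poweR //.
    by apply/negbTE/set0P; exists x.
  move: dle (Fd i) d0 vE; rewrite -(fineK dfin) /= !lee_fin.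
  set d := fine _ => xd d1 d0 vE.
  apply: le_lt_trans xd _; rewrite ltNge; apply/negP => rd.
  have : r i `^ s <= d `^ s.
    by apply: ge0_ler_powR; rewrite ?nnegrE ?(ltW s_gt0) ?(ltW (r0 i)).
  have : d `^ s <= d `^ s0.
    move: d0; rewrite le_eqVlt => /orP[/eqP <-|d_gt0].
      by rewrite powR0 ?gt_eqF // powR_ge0.
    by apply: ger_powR; rewrite ?d_gt0 // ltW.
  by rewrite rs -vE; move: (q0 i); lra.
- move=> N; under eq_bigr => i _ do rewrite rs.
  rewrite big_split /= -mulr_sumr.
  have : \sum_(i < N) v i <= e / 2.
    rewrite -lee_fin -sumEFin; apply: le_trans (ltW (part N)).
    by rewrite big_mkord; apply: lee_sum => i _; rewrite /v fineK.
  by have := sum_half N; nra.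
Qed.

Lemma hausdorff_dim_le1 A : A `<=` Xv R -> (hausdorff_dim A <= 1%:E)%E.
Proof.
move=> AX; apply: hausdorff_dim_le => // t t1 delta e delta0 e0.
(* The first summand makes intervals of length [1 / n.+1] shorter than [delta]; the second makes
   their [t]-sum, which is [n.+1] to the power [1 - t], at most [e]. *)
have [n Hn] : exists n : nat, delta^-1 + e^-1 `^ (t - 1)^-1 < n.+1%:R.
  exists (Num.truncn (delta^-1 + e^-1 `^ (t - 1)^-1)).
  exact: truncnS_gt.
have n0 : 0 < n.+1%:R :> R by [].
pose F i := if (i < n.+1)%N
  then [set x : R | i%:R / n.+1%:R - 2^-1 <= x <= i.+1%:R / n.+1%:R - 2^-1]
  else set0.
exists F, (fun=> n.+1%:R^-1); split.
- move=> x /AX; rewrite /Xv /= in_itv /= => /andP[x1 x2].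
  pose y := (x + 2^-1) * n.+1%:R.
  have y0 : 0 <= y by rewrite mulr_ge0 //; lra.
  have yn : y <= n.+1%:R by rewrite ler_piMl //; lra.
  (* The right endpoint goes into the last interval, since rounding down would give the index
     [n.+1], whose set is empty. *)
  have [->|xn] := eqVneq x 2^-1.
    exists n => //; rewrite /F ltnS leqnn /= divff ?gt_eqF //.
    have : n%:R / n.+1%:R <= 1 :> R by rewrite ler_pdivrMr // mul1r ler_nat.
    by move: (_ / _ : R) => q q1; apply/andP; split; lra.
  have yn' : y < n.+1%:R by rewrite gtr_pMl //; lra.
  have /andP[t0 t2] := truncn_itv y0.
  exists (Num.truncn y) => //; rewrite /F ifT.
    by rewrite /= lerBlDr ler_pdivrMr // lerBrDr ler_pdivlMr // t0 ltW.
  by rewrite -(ltr_nat R); apply: le_lt_trans yn'.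
- move=> _; rewrite invr_ge0 ltW // invf_ple ?posrE //=.
  by rewrite ltW // (le_lt_trans _ Hn) // lerDl powR_ge0.
- move=> i x y; rewrite /F; case: ifP => // _ /= /andP[x1 x2] /andP[y1 y2].
  rewrite -natr1 mulrDl mul1r in x2 y2; move: x1 x2 y1 y2; rewrite ler_norml.
  have -> : i%:R / n.+1%:R = i%:R * n.+1%:R^-1 :> R by [].
  set p := (i%:R * _); set q := (n.+1%:R^-1).
  by move: p q => p q x1 x2 y1 y2; apply/andP; split; lra.
move=> N.
apply: (@le_trans _ _ (\sum_(i < n.+1) n.+1%:R^-1 `^ t)).
  rewrite (eq_bigl (fun i : 'I_N => (i < n.+1)%N && (F i != set0))); last first.
    by move=> i; rewrite /F; case: ifP => //=; rewrite eqxx.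
  rewrite big_mkcondr /=.
  apply: (@le_trans _ _ (\sum_(i < N | (i < n.+1)%N) n.+1%:R^-1 `^ t)).
    by apply: ler_sum => i _; case: ifP => // _; exact: powR_ge0.
  rewrite -(big_mkord (fun i => i < n.+1)%N (fun=> n.+1%:R^-1 `^ t)).
  rewrite -(big_mkord xpredT (fun=> n.+1%:R^-1 `^ t)) -big_filter.
  apply: sum_uniq_subset => [|i|i _]; last exact: powR_ge0.
    by rewrite filter_uniq ?iota_uniq.
  by rewrite mem_filter !mem_index_iota => /andP[].
rewrite sumr_const card_ord -[leLHS]mulr_natl.
have -> : t = (t - 1) + 1 by ring.
rewrite powRD; last by apply/implyP => _; rewrite invr_eq0 gt_eqF.
rewrite powRr1 ?invr_ge0 // mulrCA divff ?gt_eqF // mulr1.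
rewrite -[n.+1%:R^-1]powR_inv1 // -powRrM mulN1r powRN.
rewrite invf_ple ?posrE ?powR_gt0 //.
have -> : e^-1 = (e^-1 `^ (t - 1)^-1) `^ (t - 1).
  by rewrite -powRrM mulVf ?powRr1 ?invr_ge0 ?(ltW e0) // gt_eqF //; lra.
apply: ge0_ler_powR; rewrite ?nnegrE ?powR_ge0 //; first by lra.
by rewrite ltW // (le_lt_trans _ Hn) // lerDr invr_ge0 ltW.
Qed.

End HausdorffDimension.

(** * The limit set and the upper bound *)

Section LimitSet.
Context {R : realType}.
Implicit Types (D : set (seq int)) (w : nat -> seq int) (s t x y : R).

Notation lim_set := (limit_set (Xv R) (@phi_word R)).

Lemma mkseqSl (T : Type) (w : nat -> T) n :
  mkseq w n.+1 = w 0 :: mkseq (w \o S) n.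
Proof. by rewrite /mkseq /= (iotaDl 1 0) -map_comp. Qed.

Lemma ifs_prefixE w n :
  ifs_prefix (@phi_word R) w n = phi_word (flatten (mkseq w n)).
Proof.
rewrite /ifs_prefix; elim: n w => [|n IH] w.
  by rewrite big_ord0; apply/funext => x; rewrite /= Defs.phi_word0.
rewrite big_ord_recl mkseqSl /=; apply/funext => x.
rewrite phi_word_cat -(IH (w \o S)) /=; congr phi_word.
Qed.

Lemma mkseq_on D w n : (forall i, D (w i)) -> word_on D (mkseq w n).
Proof. by move=> Dw _ /mapP[i _ ->]. Qed.

Lemma limit_set_cover D n : D `<=` Ebar -> (0 < n)%N -> forall x, lim_set D x ->
  exists u, [/\ word_on D u, size u = n & (phi_word (flatten u) @` Xv R) x].
Proof.
move=> DE n0 x [w Dw wx]; exists (mkseq w n).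
rewrite size_mkseq; split=> //; first exact: mkseq_on.
by rewrite -ifs_prefixE; have : [set x] x by []; rewrite -wx => /(_ n n0).
Qed.

(** The limit set is covered by the cylinders of level [n]. By distortion their diameters are at
    most [9 * scale (flatten u) 0 ^+ 2], and for [t > s] the [t]-sums decay geometrically in [n] by
    [Zsum_decay]. *)
Lemma dim_limit_set_le D s (M : R) : D `<=` Ebar -> 0 <= s ->
  (forall F n, uniq F -> word_on D F -> Zsum F s n 0 <= M) ->
  (hausdorff_dim (lim_set D) <= s%:E)%E.
Proof.
move=> DE s0 ZM; apply: hausdorff_dim_le => // t st delta e delta0 e0.
have X0 := @norm0_le_half R.
pose q : R := 2^-1 `^ (2 * (t - s)).
have q01 : 0 <= q < 1 := half_powR_itv st.
have [N1 HN1] := geometric_small (9 `^ t * M) q01 e0.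
have h01 : 0 <= (4^-1 : R) < 1 by lra.
have [N2 HN2] := geometric_small 9 h01 delta0.
have M0 : 0 <= M.
  by apply: le_trans (ZM [::] 0 isT _) => //; rewrite Zsum0.
pose n := (maxn N1 N2).+1.
have le_exp (r : R) m : 0 <= r < 1 -> (m <= n)%N -> r ^+ n <= r ^+ m.
  by move=> /andP[? /ltW ?] mn; rewrite ler_wiXn2l.
have HN1' : 9 `^ t * M * q ^+ n <= e.
  apply: le_trans HN1; rewrite ler_wpM2l ?mulr_ge0 ?powR_ge0 // le_exp //.
  by rewrite leqW // leq_maxl.
have HN2' : 9 * 4^-1 ^+ n <= delta.
  apply: le_trans HN2; rewrite ler_wpM2l // le_exp //.
  by rewrite leqW // leq_maxr.
pose P (u : seq (seq int)) := (size u == n) && `[< word_on D u >].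
pose g (u : seq (seq int)) : R := 9 * scale (flatten u) 0 ^+ 2.
have g0 u : 0 <= g u by rewrite mulr_ge0 // exprn_ge0 // scale_ge0.
(* Words are indexed by their codes; an index that codes no word of length [n] over [D] receives the
   empty set, which costs nothing. *)
pose u_ i : option (seq (seq int)) := pickle_inv i.
pose U i := if u_ i is Some u then
  if P u then phi_word (flatten u) @` Xv R else set0 else set0.
pose d i := if u_ i is Some u then if P u then g u else 0 else 0.
exists U, d; rewrite /U /d; split.
- move=> x /(@limit_set_cover D n DE isT)[u [Du un ux]].
  exists (pickle u) => //; rewrite /u_ pickleK_inv.
  by rewrite /P un eqxx; case: asboolP.
- move=> i; case: (u_ i) => [u|]; last by rewrite lexx ltW.
  case: ifP => [/andP[/eqP un /asboolP Du]|_]; last by rewrite lexx ltW.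
  rewrite g0 /=; apply: le_trans HN2'; rewrite ler_wpM2l //.
  have -> : 4^-1 = 2^-1 ^+ 2 :> R by field.
  rewrite -exprM mulnC exprM ler_sqr ?nnegrE ?scale_ge0 ?exprn_ge0 ?invr_ge0 //.
  have Eu : word_on Ebar u by move=> k /Du /DE.
  by have /andP[_] := word_scale_le Eu X0; rewrite un.
- move=> i x y; case: (u_ i) => [u|] //.
  case: ifP => // /andP[_ /asboolP Du].
  have Eu : word_on Ebar u by move=> k /Du /DE.
  move=> [x' /XvE Xx <-] [y' /XvE Xy <-]; rewrite word_dist //.
  have x3 := word_distortion Eu Xx X0; have y3 := word_distortion Eu Xy X0.
  have : `|x' - y'| <= 1.
    by move: Xx Xy; rewrite !ler_norml; lra.
  rewrite /g; move: (scale_ge0 (flatten u) x') (scale_ge0 (flatten u) y') x3 y3.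
  move: (scale _ x') (scale _ y') (scale _ 0) => a b c a0 b0 ac bc d1.
  apply: (@le_trans _ _ (a * b)); first by rewrite ler_piMr // mulr_ge0.
  have -> : 9 * c ^+ 2 = (3 * c) * (3 * c) by ring.
  exact: ler_pM.
(* Although [D] may be infinite, a partial sum involves finitely many words, whose letters form the
   finite system [F0]. *)
move=> N; pose W := [seq u <- pmap u_ (iota 0 N) | P u].
pose F0 := undup (flatten W).
have uW : uniq W.
  rewrite filter_uniq // (@pmap_uniq _ _ u_ pickle) ?iota_uniq //.
  exact: pickle_invK.
have F0D : word_on D F0.
  move=> k; rewrite mem_undup => /flattenP[u].
  by rewrite mem_filter => /andP[/andP[_ /asboolP Du] _] /Du.
apply: (@le_trans _ _ (\sum_(u <- W) g u `^ t)).
  rewrite big_filter -[leLHS](big_mkord (fun i => U i != set0) (fun i => d i `^ t)).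
  rewrite /index_iota subn0; elim: (iota 0 N) => [|i r IH].
    by rewrite !big_nil.
  rewrite big_cons /= {1}/U {1}/d; case: (u_ i) => [u|] /=; last by rewrite eqxx.
  rewrite big_cons; case: (P u); last by rewrite eqxx.
  case: ifP => _; first by rewrite lerD2l.
  by apply: ler_wpDl; rewrite ?powR_ge0.
apply: (@le_trans _ _ (\sum_(u <- words F0 n) g u `^ t)).
  apply: sum_uniq_subset => // [u uW'|u _]; last exact: powR_ge0.
  move: (uW'); rewrite mem_words mem_filter => /andP[/andP[/eqP -> _] _].
  rewrite eqxx; apply/allP => k ku; rewrite mem_undup; apply/flattenP.
  by exists u.
apply: le_trans HN1'.
have -> : \sum_(u <- words F0 n) g u `^ t = 9 `^ t * Zsum F0 t n 0.
  rewrite mulr_sumr; apply: eq_bigr => u _.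
  rewrite /g powRM ?exprn_ge0 ?scale_ge0 //; congr (_ * _).
  by rewrite -powR_mulrn ?scale_ge0 // -powRrM.
rewrite -mulrA ler_wpM2l ?powR_ge0 //.
have EF0 : word_on Ebar F0 by move=> k /F0D /DE.
apply: le_trans (Zsum_decay _ EF0 (ltW st) X0) _.
rewrite mulrC; apply: ler_wpM2r; first by rewrite exprn_ge0 ?powR_ge0.
by apply: ZM => //; exact: undup_uniq.
Qed.

Definition approx w n : R := phi_word (flatten (mkseq w n)) 0.

(** The limit of [approx w n]: the intervals of radius [4 ^ (- n)] around these points meet
    pairwise, so the supremum of their left ends lies in all of them. *)
Definition coding w : R := sup (range (fun n => approx w n - 4^-1 ^+ n)).

Lemma prefix_contract w n x y : (forall i, Ebar (w i)) ->
  `|x| <= 2^-1 -> `|y| <= 2^-1 ->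
  `|phi_word (flatten (mkseq w n)) x - phi_word (flatten (mkseq w n)) y|
    <= 4^-1 ^+ n * `|x - y|.
Proof.
move=> Ew Xx Xy; have Eu : word_on Ebar (mkseq w n) by exact: mkseq_on.
rewrite word_dist // ler_wpM2r //.
have /andP[a0 a1] := word_scale_le Eu Xx.
have /andP[b0 b1] := word_scale_le Eu Xy.
rewrite size_mkseq in a1 b1.
have -> : 4^-1 = 2^-1 * 2^-1 :> R by field.
by rewrite exprMn; apply: ler_pM => //; exact: ltW.
Qed.

Lemma approx_stable w n : (forall i, Ebar (w i)) -> `|approx w n| <= 2^-1.
Proof. by move=> Ew; apply: word_stable norm0_le_half; exact: mkseq_on. Qed.

Lemma approx_addn w n m :
  approx w (n + m) = phi_word (flatten (mkseq w n)) (approx (fun i => w (n + i)%N) m).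
Proof.
rewrite /approx -phi_word_cat -flatten_cat /mkseq iotaD add0n map_cat.
by congr (phi_word (flatten (_ ++ _)) 0); rewrite -{1}[n]addn0 iotaDl -map_comp.
Qed.

Lemma approx_dist w n m : (forall i, Ebar (w i)) ->
  `|approx w (n + m) - approx w n| <= 4^-1 ^+ n.
Proof.
move=> Ew; rewrite approx_addn.
have Xa := @approx_stable (fun i => w (n + i)%N) m (fun i => Ew _).
apply: le_trans (prefix_contract _ Ew Xa norm0_le_half) _.
rewrite ler_piMr ?exprn_ge0 ?invr_ge0 // subr0 (le_trans Xa) //; lra.
Qed.

Lemma coding_approx w n : (forall i, Ebar (w i)) ->
  `|coding w - approx w n| <= 4^-1 ^+ n.
Proof.
move=> Ew.
have H m k : approx w m - 4^-1 ^+ m <= approx w k + 4^-1 ^+ k.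
  have p i : 0 <= 4^-1 ^+ i :> R by rewrite exprn_ge0 // invr_ge0.
  have [/subnKC <-|/ltnW/subnKC <-] := leqP m k.
    by have := @approx_dist w m (k - m) Ew; rewrite ler_norml; move: (p (m + (k - m))%N); lra.
  by have := @approx_dist w k (m - k) Ew; rewrite ler_norml; move: (p (k + (m - k))%N); lra.
rewrite ler_distl; apply/andP; split.
  apply: ub_le_sup; last by exists n.
  by exists (approx w 0 + 4^-1 ^+ 0) => _ [m _ <-]; exact: H.
by apply: ge_sup => [|_ [m _ <-]]; [exists (approx w 0 - 4^-1 ^+ 0), 0|exact: H].
Qed.

Lemma le_geo (a c : R) : (forall n, a <= c * 4^-1 ^+ n) -> a <= 0.
Proof.
move=> H; apply/ler_addgt0Pr => e e0; rewrite add0r.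
have [|N] := @geometric_small R c 4^-1 e _ e0; first by lra.
exact: le_trans.
Qed.

Lemma coding_le w : (forall i, Ebar (w i)) -> `|coding w| <= 2^-1.
Proof.
move=> Ew; rewrite -subr_le0; apply: (@le_geo _ 1) => n.
have := coding_approx n Ew; have := @approx_stable w n Ew.
have := ler_normD (coding w - approx w n) (approx w n); rewrite subrK; lra.
Qed.

Lemma coding_shift w n : (forall i, Ebar (w i)) ->
  coding w = phi_word (flatten (mkseq w n)) (coding (fun i => w (n + i)%N)).
Proof.
move=> Ew; set w' := fun i => w (n + i)%N; have Ew' i : Ebar (w' i) by exact: Ew.
apply/eqP; rewrite -subr_eq0 -normr_le0; apply: (@le_geo _ 2) => m.
have H1 := coding_approx (n + m) Ew.
have H2 := prefix_contract n Ew (coding_le Ew') (approx_stable m Ew').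
have H3 := coding_approx m Ew'; rewrite -approx_addn in H2.
have p i : 0 <= (4^-1 : R) ^+ i <= 1 by rewrite exprn_ge0 ?exprn_ile1 //; lra.
have H4 : 4^-1 ^+ (n + m) <= 4^-1 ^+ m :> R.
  by rewrite exprD ler_piMl //; case/andP: (p n); case/andP: (p m).
have H5 : 4^-1 ^+ n * `|coding w' - approx w' m| <= 4^-1 ^+ m.
  apply: le_trans H3; rewrite ler_piMl //; by case/andP: (p n).
move: (ler_distD (approx w (n + m)) (coding w)
  (phi_word (flatten (mkseq w n)) (coding w'))).
by rewrite (distrC (approx _ _) (phi_word _ _)); lra.
Qed.

Lemma coding_limit D w : D `<=` Ebar -> (forall i, D (w i)) ->
  lim_set D (coding w).
Proof.
move=> DE Dw; exists w => //; have Ew i : Ebar (w i) by exact: DE.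
apply/seteqP; split=> [y /= Hy|y /= -> n _]; last first.
  rewrite ifs_prefixE (coding_shift n Ew).
  by exists (coding (fun i => w (n + i)%N)) => //; apply/XvE/coding_le.
apply/eqP; rewrite -subr_eq0 -normr_le0; apply: (@le_geo _ 2) => n.
(* The intersection starts at level [1], so the bound for [n = 0] comes from the fact that both
   points lie in [Xv]. *)
have [->|n0] := posnP n.
  have [x /XvE Xx <-] := Hy 1%N isT; rewrite ifs_prefixE.
  have Eu : word_on Ebar (mkseq w 1) by exact: mkseq_on.
  have := word_stable Eu Xx; have := coding_le Ew; rewrite !ler_norml; lra.
have [x /XvE Xx <-] := Hy n n0; rewrite ifs_prefixE.
have := prefix_contract n Ew Xx norm0_le_half; rewrite -/(approx w n) subr0.
have : 4^-1 ^+ n * `|x| <= 4^-1 ^+ n.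
  by rewrite ler_piMr ?exprn_ge0 ?invr_ge0 //; lra.
have := coding_approx n Ew; rewrite distrC.
move: (ler_distD (approx w n) (phi_word (flatten (mkseq w n)) x) (coding w)).
lra.
Qed.

End LimitSet.

(** * The lower bound *)

Section Mass.
Context {R : realType} {T : eqType}.
Variables (G : seq T) (g : T -> R -> R) (a : T -> R) (h s gap : R).
Hypothesis h0 : 0 <= h.
Hypothesis gK : forall i x, i \in G -> `|x| <= h -> `|g i x| <= h.
Hypothesis a_itv : forall i, i \in G -> 0 < a i <= 4^-1.
Hypothesis g_expand : forall i x y, i \in G -> `|x| <= h -> `|y| <= h ->
  a i * `|x - y| <= `|g i x - g i y|.
Hypothesis gap0 : 0 < gap.
Hypothesis g_gap : forall i j x y, i \in G -> j \in G -> i != j ->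
  `|x| <= h -> `|y| <= h -> gap <= `|g i x - g j y|.
Hypothesis uG : uniq G.
Hypothesis s0 : 0 <= s.
Hypothesis sum_a : 1 <= \sum_(i <- G) a i `^ s.

Let p i := a i `^ s / \sum_(j <- G) a j `^ s.

Let sum_gt0 : 0 < \sum_(i <- G) a i `^ s.
Proof. by apply: lt_le_trans sum_a. Qed.

Let p_ge0 i : 0 <= p i.
Proof. by rewrite divr_ge0 ?powR_ge0 // ltW. Qed.

Let p_le i : p i <= a i `^ s.
Proof. by rewrite ler_pdivrMr // ler_peMr // powR_ge0. Qed.

Let sum_p : \sum_(i <- G) p i = 1.
Proof. by rewrite -mulr_suml divff // gt_eqF. Qed.

(* The total weight of the cylinders of level [k] that meet [U]. *)
Fixpoint mass (k : nat) (U : set R) : R :=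
  if k is m.+1 then \sum_(i <- G) p i * mass m (g i @^-1` U)
  else if `[< exists2 x, `|x| <= h & U x >] then 1 else 0.

Let mass_ge0 k U : 0 <= mass k U.
Proof.
elim: k U => [|k IH] U /=; first by case: ifP.
by apply: sumr_ge0 => i _; rewrite mulr_ge0.
Qed.

Let mass_le1 k U : mass k U <= 1.
Proof.
elim: k U => [|k IH] U /=; first by case: ifP.
by rewrite -sum_p; apply: ler_sum => i _; rewrite ler_piMr.
Qed.

Let mass_eq0 k U : (forall x, `|x| <= h -> ~ U x) -> mass k U = 0.
Proof.
elim: k U => [|k IH] U HU /=.
  by case: asboolP => // -[x Kx Ux]; case: (HU x).
rewrite big_seq big1 // => i iG; rewrite IH ?mulr0 // => x Kx.
by apply: HU; exact: gK.
Qed.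

(** A set of diameter less than [gap] meets the image of at most one letter [i]. Pulling back by
    [g i] divides the diameter bound by [a i], and the weight [p i], at most the [s]-th power of
    [a i], compensates exactly. As [a i <= 1/4], the condition on [rho] passes to level [k - 1]. *)
Let mass_le k U (rho : R) : gap * 4^-1 ^+ k <= rho ->
  (forall x y, `|x| <= h -> `|y| <= h -> U x -> U y -> `|x - y| <= rho) ->
  mass k U <= (rho / gap) `^ s.
Proof.
have large k' U' (r : R) : gap <= r -> mass k' U' <= (r / gap) `^ s.
  move=> gr; apply: le_trans (mass_le1 _ _) _.
  rewrite (_ : 1 = 1 `^ s); last by rewrite powR1.
  apply: ge0_ler_powR; rewrite ?nnegrE //.
    by rewrite divr_ge0 ?(ltW gap0) // (le_trans (ltW gap0)).
  by rewrite ler_pdivlMr // mul1r.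
elim: k U rho => [|k IH] U rho k_rho Urho.
  by apply: large; rewrite expr0 mulr1 in k_rho.
have [/large//|rho_gap] := leP gap rho.
have rho0 : 0 < rho by apply: lt_le_trans k_rho; rewrite mulr_gt0 // exprn_gt0 // invr_gt0.
have [[i iG [x Kx Ux]]|none] :=
    pselect (exists2 i, i \in G & exists2 x, `|x| <= h & U (g i x)).
  rewrite /= (bigD1_seq i) //= big_seq_cond big1 ?addr0 => [|j /andP[jG ji]]; last first.
    rewrite mass_eq0 ?mulr0 // => y Ky /= Uy.
    have := g_gap jG iG ji Ky Kx.
    by have := Urho _ _ (gK jG Ky) (gK iG Kx) Uy Ux; lra.
  have /andP[ai0 ai1] := a_itv iG.
  apply: (@le_trans _ _ (a i `^ s * (rho / a i / gap) `^ s)).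
    apply: ler_pM => //; apply: IH.
      rewrite ler_pdivlMr //; apply: le_trans k_rho.
      rewrite exprSr mulrA; apply: ler_wpM2l => //.
      by apply: mulr_ge0; [exact: ltW|rewrite exprn_ge0 // invr_ge0].
    move=> y z Ky Kz Uy Uz; rewrite ler_pdivlMr // mulrC.
    by apply: le_trans (g_expand iG Ky Kz) _; apply: Urho => //; exact: gK.
  rewrite -powRM ?(ltW ai0) ?divr_ge0 ?(ltW rho0) ?(ltW gap0) ?(ltW ai0) //.
  by rewrite mulrA mulrCA divff ?gt_eqF // mulr1.
rewrite /= big_seq big1 ?powR_ge0 // => i iG.
by rewrite mass_eq0 ?mulr0 // => x Kx Ux; apply: none; exists i => //; exists x.
Qed.

(** The mass is subadditive with total [1]; it is enough that each cylinder of level [k] lies in a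
    single [V i]. *)
Let mass_cover k N (V : nat -> set R) :
  (forall W, size W = k -> {subset W <= G} ->
    exists2 i, (i < N)%N & forall x, `|x| <= h -> V i (foldr g x W)) ->
  1 <= \sum_(i < N) mass k (V i).
Proof.
elim: k V => [|k IH] V HV.
  have [//|i iN Vi] := HV [::] erefl.
  rewrite (bigD1 (Ordinal iN)) //= ler_wpDr ?sumr_ge0 //.
    by move=> j _; case: ifP.
  by case: asboolP => // -[]; exists 0; rewrite ?normr0 //; apply: Vi; rewrite normr0.
rewrite exchange_big /= -[leLHS]sum_p [leLHS]big_seq [leRHS]big_seq.
apply: ler_sum => j jG; rewrite -mulr_sumr ler_peMr //.
apply: (IH (fun i => g j @^-1` V i)) => W Wk WG.
have [|l|i iN Vi] := HV (j :: W); first by rewrite /= Wk.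
  by rewrite inE => /orP[/eqP->|/WG].
by exists i.
Qed.

Lemma mass_distribution k N (c r : nat -> R) :
  (forall i, (i < N)%N -> gap * 4^-1 ^+ k <= 2 * r i) ->
  (forall W, size W = k -> {subset W <= G} ->
    exists2 i, (i < N)%N & forall x, `|x| <= h -> `|foldr g x W - c i| < r i) ->
  1 <= \sum_(i < N) (2 * r i / gap) `^ s.
Proof.
move=> kr cover.
apply: le_trans (@mass_cover k N (fun i => [set x | `|x - c i| < r i]) cover) _.
apply: ler_sum => i _; apply: mass_le => [|x y _ _ /= xi yi]; first exact: kr.
have := ler_distD (c i) x y; rewrite (distrC (c i)); lra.
Qed.

End Mass.

(** * Compactness of the space of sequences over a finite alphabet *)

Section Konig.
Variables (T : eqType) (F : seq T) (t0 : T).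

Lemma finite_max (Q : T -> nat -> Prop) :
  (forall t k l, (k <= l)%N -> Q t k -> Q t l) ->
  (forall t, t \in F -> exists k, Q t k) -> exists k, forall t, t \in F -> Q t k.
Proof.
move=> mono; elim: F => [|a A IH] H; first by exists 0.
have [k Hk] := IH (fun t tA => H t (ltac:(by rewrite inE tA orbT))).
have [l Hl] := H a (mem_head _ _).
exists (maxn k l) => t; rewrite inE => /orP[/eqP->|/Hk].
  exact: mono (leq_maxr _ _) Hl.
exact: mono (leq_maxl _ _).
Qed.

(** In the application [B u i] says that the cylinder of [u] lies in the [i]-th ball. A word without
    a uniform bound has a one-letter extension without one, since finitely many bounds have a
    maximum; iterating yields a branch that contradicts the second hypothesis. One [k] bounds both
    the length and the index. *)
Lemma konig (B : seq T -> nat -> Prop) :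
  (forall u v i, {subset v <= F} -> B u i -> B (u ++ v) i) ->
  (forall w : nat -> T, (forall i, w i \in F) -> exists n i, B (mkseq w n) i) ->
  exists k, forall v, size v = k -> {subset v <= F} -> exists2 i, (i < k)%N & B v i.
Proof.
move=> mono bar.
pose goodk u k :=
  forall v, size v = k -> {subset v <= F} -> exists2 i, (i < k)%N & B (u ++ v) i.
pose good u := exists k, goodk u k.
have goodk_mono u k l : (k <= l)%N -> goodk u k -> goodk u l.
  move=> kl Hk v vl vF.
  have [|x xv|i ik Bi] := Hk (take k v); first by rewrite size_takel ?vl.
    by apply: vF; exact: mem_take xv.
  exists i; first exact: leq_trans kl.
  rewrite -(cat_take_drop k v) catA; apply: mono => // x xv.
  by apply: vF; exact: mem_drop xv.
have step u : ~ good u -> exists t, t \in F /\ ~ good (rcons u t).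
  move=> nu; apply: contrapT => H; apply: nu.
  have [t k l|t tF|k Hk] := @finite_max (fun t => goodk (rcons u t)).
  - exact: goodk_mono.
  - by apply: contrapT => nt; apply: H; exists t.
  exists k.+1 => -[//|t v] [vk] vF.
  have [||i ik Bi] := Hk t _ v vk.
  - by apply: vF; exact: mem_head.
  - by move=> x xv; apply: vF; rewrite inE xv orbT.
  by exists i; [exact: ltnW|rewrite -cat_rcons].
(* [t0] is only the value of [f] at good words. *)
have /choice[f Hf] u : exists t, ~ good u -> t \in F /\ ~ good (rcons u t).
  by have [gu|/step[t Ht]] := pselect (good u); [exists t0|exists t].
apply: contrapT => nil_bad; have {}nil_bad : ~ good [::] by [].
pose X n := iter n (fun u => rcons u (f u)) [::].
have X_bad n : ~ good (X n).
  by elim: n => [//|n IH]; have [] := Hf _ IH.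
have XE n : X n = mkseq (f \o X) n.
  by elim: n => [//|n IH]; rewrite mkseqS -IH.
have [|n [i Bi]] := bar (f \o X); first by move=> i; have [] := Hf _ (X_bad i).
apply: (X_bad n); exists i.+1 => v _ vF; exists i => //.
by rewrite XE; exact: mono.
Qed.

End Konig.

(** * Separation of cylinders *)

Section Separation.
Context {R : realType}.
Implicit Types (tau : seq int) (f g : R -> R) (h x y : R).

Lemma finite_lower_bound (T : eqType) (F : seq T) (Q : T -> R -> Prop) :
  (forall t a b, b <= a -> Q t a -> Q t b) ->
  (forall t, t \in F -> exists2 a, 0 < a & Q t a) ->
  exists2 a, 0 < a & forall t, t \in F -> Q t a.
Proof.
move=> mono; elim: F => [|t0 F IH] H; first by exists 1.
have [a a0 Ha] := IH (fun t tF => H t (ltac:(by rewrite inE tF orbT))).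
have [b b0 Hb] := H t0 (mem_head _ _).
exists (Num.min a b) => [|t]; first by rewrite lt_min a0.
rewrite inE => /orP[/eqP->|/Ha].
  by apply: mono Hb; rewrite ge_min lexx orbT.
by apply: mono; rewrite ge_min lexx.
Qed.

Definition separated h f g := exists2 e : R, 0 < e &
  forall x y, `|x| <= h -> `|y| <= h -> e <= `|f x - g y|.

Lemma separatedC h f g : separated h f g -> separated h g f.
Proof. by case=> e e0 H; exists e => // x y Kx Ky; rewrite distrC H. Qed.

Lemma inv_dist (a b A B d : R) : 0 < a <= A -> 0 < b <= B -> 0 <= d ->
  d <= `|a - b| -> d / (A * B) <= `|a^-1 - b^-1|.
Proof.
move=> /andP[a0 aA] /andP[b0 bB] d0 dab.
have -> : a^-1 - b^-1 = (b - a) / (a * b) by field; rewrite !gt_eqF.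
rewrite normrM distrC normfV (ger0_norm (mulr_ge0 (ltW a0) (ltW b0))).
have A0 : 0 < A by apply: lt_le_trans aA.
have B0 : 0 < B by apply: lt_le_trans bB.
apply: ler_pM => //; first by rewrite invr_ge0 mulr_ge0 // ltW.
by rewrite lef_pV2 ?posrE ?mulr_gt0 // ler_pM // ltW.
Qed.

(** Common leading letters [2] are stripped. Then either two single letters remain, with
    denominators at least [1 - 2 * h] apart, or a denominator at most [5/2] stands against one at
    least [3 - h]. *)
Lemma letter_separated_pos h n j n' j' : 0 <= h < 2^-1 -> (n, j) != (n', j') ->
  separated h (phi_word (letter false n j)) (phi_word (letter false n' j')).
Proof.
move=> /andP[h0 h1].
have in_X (x : R) : `|x| <= h -> `|x| <= 2^-1 by move=> Kx; lra.
have pos0 k : 0 <= k%:R :> R := ler0n _ _.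
have base i m k : separated h (phi_word (letter false 0 i))
    (phi_word (letter false m.+1 k)).
  exists ((2^-1 - h) / ((i%:R + 4) * 3)) => [|x y Kx Ky].
    by rewrite divr_gt0 ?mulr_gt0 //; have := pos0 i; lra.
  have /andP[y1 y2] := letter_ge0 m k (in_X _ Ky).
  have {}y1 : 0 <= phi_word (letter false m k) y.
    by apply: le_trans y1; rewrite invr_ge0.
  have {}y2 : phi_word (letter false m k) y <= 2^-1.
    by apply: le_trans y2 _; rewrite gerBl invr_ge0.
  rewrite letterS letter0 !Defs.phi_word_cons Defs.phi_word0 /phi -pmulrn natrD.
  move: (pos0 i) Kx; rewrite ler_norml => i0 ?.
  apply: inv_dist; try lra.
  by rewrite ger0_norm; lra.
elim: n n' => [|n IH] [|n'] nj //.
- have {}nj : j != j' by apply: contra nj => /eqP->.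
  exists ((1 - 2 * h) / ((j%:R + 4) * (j'%:R + 4))) => [|x y Kx Ky].
    by rewrite divr_gt0 ?mulr_gt0 //; have := pos0 j; have := pos0 j'; lra.
  rewrite !letter0 !Defs.phi_word_cons !Defs.phi_word0 /phi -!pmulrn !natrD.
  move: (pos0 j) (pos0 j') Kx Ky; rewrite !ler_norml => ? ? ? ?.
  apply: inv_dist; try lra.
  have [jj|jj|jj] := ltngtP j j'; last by rewrite jj eqxx in nj.
    have : j%:R + 1 <= j'%:R :> R by rewrite natr1 ler_nat.
    by rewrite distrC => ?; rewrite ger0_norm; lra.
  have : j'%:R + 1 <= j%:R :> R by rewrite natr1 ler_nat.
  by move=> ?; rewrite ger0_norm; lra.
- exact/separatedC/base.
- have [|e e0 He] := IH n'; first by apply: contra nj => /eqP[-> ->].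
  exists (e / (3 * 3)) => [|x y Kx Ky]; first by rewrite divr_gt0.
  rewrite !letterS !(Defs.phi_word_cons 2) /phi.
  have b m k z : `|z| <= h -> 0 <= phi_word (letter false m k) z <= 2^-1.
    move=> Kz; have /andP[z1 z2] := letter_ge0 m k (in_X _ Kz).
    rewrite (le_trans _ z1) ?invr_ge0 //=.
    by apply: le_trans z2 _; rewrite gerBl invr_ge0.
  have := b n j x Kx; have := b n' j' y Ky; have := He x y Kx Ky.
  move: (phi_word _ x) (phi_word _ y) => u v uv v0 u0.
  apply: inv_dist; try lra.
  by rewrite [2%:~R + u]addrC addrKA.
Qed.

Lemma letter_separated h tau tau' : Ebar tau -> Ebar tau' -> tau != tau' ->
  0 <= h < 2^-1 -> separated h (phi_word tau) (phi_word tau').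
Proof.
move=> /EbarP[b [n [j ->]]] /EbarP[b' [n' [j' ->]]] ne h01.
have mixed m k m' k' : separated h (phi_word (letter false m k))
    (phi_word (letter true m' k')).
  have in_X (x : R) : `|x| <= h -> `|x| <= 2^-1 by move=> Kx; lra.
  exists (k + 4)%:R^-1 => [|x y Kx Ky]; first by rewrite invr_gt0 ltr0n addn_gt0 orbT.
  have Ky' : `|- y| <= h by rewrite normrN.
  have /andP[x1 _] := letter_ge0 m k (in_X _ Kx).
  have /andP[y1 _] := letter_ge0 m' k' (in_X _ Ky').
  rewrite -[y]opprK letterN phi_wordN opprK.
  have y0 : 0 <= phi_word (letter false m' k') (- y).
    by apply: le_trans y1; rewrite invr_ge0.
  apply: le_trans (ler_norm _); apply: le_trans x1 _.
  by rewrite lerDl.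
case: b b' ne => -[] ne.
- have [|e e0 He] := @letter_separated_pos h n j n' j' h01.
    by apply: contra ne => /eqP[-> ->].
  exists e => // x y Kx Ky; rewrite -[x]opprK -[y]opprK !letterN !phi_wordN.
  by rewrite opprK addrC distrC He // normrN.
- exact/separatedC/mixed.
- exact: mixed.
- by apply: letter_separated_pos => //; apply: contra ne => /eqP[-> ->].
Qed.

(** Words are compared at the first letter where they differ; by distortion, each common letter [t]
    shrinks distances at most by the factor [(scale t 0 / 3) ^ 2]. *)
Lemma word_separated h (F : seq (seq int)) : word_on Ebar F -> 0 <= h < 2^-1 ->
  (forall tau x, tau \in F -> `|x| <= 2^-1 -> `|phi_word tau x| <= h) ->
  forall u v, {subset u <= F} -> {subset v <= F} -> size u = size v -> u != v ->
  separated h (phi_word (flatten u)) (phi_word (flatten v)).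
Proof.
move=> EF h01 Fh.
have in_X (x : R) : `|x| <= h -> `|x| <= 2^-1 by move=> Kx; lra.
have stable u x : {subset u <= F} -> `|x| <= h -> `|phi_word (flatten u) x| <= h.
  move=> uF Kx; elim: u uF => [|t u IH] uF /=; first by rewrite Defs.phi_word0.
  rewrite phi_word_cat; apply: Fh; first by apply: uF; exact: mem_head.
  by apply/in_X/IH => k ku; apply: uF; rewrite inE ku orbT.
elim=> [|t u IH] [|t' v] //= uF vF [uv] ne.
have tF : t \in F by apply: uF; exact: mem_head.
have t'F : t' \in F by apply: vF; exact: mem_head.
have {}uF : {subset u <= F} by move=> k ku; apply: uF; rewrite inE ku orbT.
have {}vF : {subset v <= F} by move=> k ku; apply: vF; rewrite inE ku orbT.
have [tt'|tt'] := eqVneq t t'; last first.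
  have [e e0 He] := letter_separated (EF _ tF) (EF _ t'F) tt' h01.
  by exists e => // x y Kx Ky; rewrite !phi_word_cat He // stable.
rewrite -tt'; have [|e e0 He] := IH v uF vF uv.
  by apply: contra ne => /eqP->; rewrite tt'.
have X0 := @norm0_le_half R.
have Et : word_on Ebar [:: t] by move=> k; rewrite inE => /eqP->; exact: EF.
have c0 := word_scale_gt0 Et X0; have cl z Xz := word_distortion Et X0 (Xz : `|z| <= 2^-1).
rewrite /= cats0 in c0 cl.
exists (scale t 0 / 3 * (scale t 0 / 3) * e) => [|x y Kx Ky].
  by rewrite !mulr_gt0 ?invr_gt0.
rewrite !phi_word_cat (scale_dist (EF _ tF)) ?in_X ?stable //.
have Ku := in_X _ (stable u x uF Kx); have Kv := in_X _ (stable v y vF Ky).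
have := cl _ Ku; have := cl _ Kv; have := He x y Kx Ky.
move: (phi_word _ x) (phi_word _ y) => x' y' exy; rewrite mulrC -ler_pdivrMr // => cy.
rewrite mulrC -ler_pdivrMr // => cx.
by do 2?[apply: ler_pM => //]; rewrite ?mulr_ge0 ?divr_ge0 ?(ltW c0) ?(ltW e0).
Qed.

Lemma letters_shrink (F : seq (seq int)) : word_on Ebar F ->
  exists2 h : R, 0 <= h < 2^-1 &
    forall tau x, tau \in F -> `|x| <= 2^-1 -> `|phi_word tau x| <= h.
Proof.
move=> EF.
have [t a b ba H x Xx|tau tF|a a0 Ha] := @finite_lower_bound _ F
    (fun tau a => forall x, `|x| <= 2^-1 -> `|phi_word tau x| <= 2^-1 - a).
- by have := H x Xx; lra.
- have [h /andP[h0 h1] H] := @letter_shrink R tau (EF _ tF).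
  by exists (2^-1 - h) => [|x /H]; lra.
have [a2|a2] := leP a 2^-1.
  by exists (2^-1 - a) => [|tau x tF /(Ha _ tF)]; first lra.
(* Here [a > 1/2], which is possible only for empty [F]. *)
exists 0 => [|tau x tF /(Ha _ tF)]; first lra.
by have := normr_ge0 (phi_word tau x); lra.
Qed.

End Separation.

(** * From the dimension of a finite system to its partition functions *)

Section LowerBound.
Context {R : realType}.

Notation lim_set := (limit_set (Xv R) (@phi_word R)).

(** If the bound failed for some [n], the words of length [n] would form a separated system
    satisfying the mass distribution principle at exponent [s], and the limit set would have no
    cover with a small [s]-sum. *)
Lemma Zsum_le_of_dim (F : seq (seq int)) (s : R) : uniq F -> word_on Ebar F ->
  (hausdorff_dim (lim_set [set` F]) < s%:E)%E ->
  forall n x, `|x| <= 2^-1 -> Zsum F s n x <= 9 `^ s.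
Proof.
move=> uF EF dim_s n x0 Xx0; rewrite leNgt; apply/negP => Z_gt.
have s_gt0 : 0 < s by rewrite -lte_fin; apply: le_lt_trans dim_s; exact: hausdorff_dim_ge0.
have X0 := @norm0_le_half R.
have n_gt0 : (0 < n)%N.
  case: n Z_gt => // ; rewrite Zsum0 ltNge => /negP[].
  rewrite [leLHS](_ : 1 = 1 `^ s); last by rewrite powR1.
  by apply: ge0_ler_powR; rewrite ?nnegrE ?(ltW s_gt0) //; lra.
have [h h01 Fh] := @letters_shrink R F EF; case/andP: (h01) => h_ge0 h_lt.
have in_X (x : R) : `|x| <= h -> `|x| <= 2^-1 by move=> Kx; lra.
set G := words F n.
have GF w : w \in G -> {subset w <= F} by rewrite mem_words => /andP[_ /allP].
have GE w (wG : w \in G) : word_on Ebar w := words_on EF wG.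
have [w a b ba H v vG wv x y Kx Ky|w wG|gap gap0 gapP] := @finite_lower_bound R _ G
   (fun w a => forall v, v \in G -> w != v -> forall x y, `|x| <= h -> `|y| <= h ->
      a <= `|phi_word (flatten w) x - phi_word (flatten v) y|).
- exact: le_trans ba (H v vG wv x y Kx Ky).
- have [v a b ba H wv x y Kx Ky|v vG|e e0 He] := @finite_lower_bound R _ G
     (fun v a => w != v -> forall x y, `|x| <= h -> `|y| <= h ->
      a <= `|phi_word (flatten w) x - phi_word (flatten v) y|).
  + exact: le_trans ba (H wv x y Kx Ky).
  + have [->|wv] := eqVneq w v; first by exists 1.
    have [|e e0 He] := word_separated EF h01 Fh (GF _ wG) (GF _ vG) _ wv.
      by rewrite (words_size wG) (words_size vG).
    by exists e.
  + by exists e => // v vG; exact: He.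
(* With this bound on the [s]-sum of the radii, the sum that mass distribution forces to be at least
   [1] is at most [1/2]. *)
have e_gt0 : 0 < (gap / 2) `^ s / 2 by rewrite divr_gt0 // ?powR_gt0 ?divr_gt0.
have [c [r [r0 cover sum_r]]] := hausdorff_dim_lt_cover dim_s e_gt0.
pose B (u : seq (seq int)) i :=
  forall x, `|x| <= 2^-1 -> `|phi_word (flatten u) x - c i| < r i.
have [u v i vF Bi x Xx|w wF|k0 Hk0] := @konig _ F [::] B.
- rewrite flatten_cat phi_word_cat; apply: Bi; apply: word_stable => //.
  by move=> t /vF /EF.
- have Ew i : Ebar (w i) by exact: EF.
  have DE : [set` F] `<=` Ebar by move=> t /= /EF.
  have [i wi] := cover _ (coding_limit DE wF).
  have d0 : 0 < r i - `|coding w - c i| by rewrite subr_gt0.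
  have [|m Hm] := @geometric_small R 2 4^-1 _ _ d0; first by lra.
  exists m, i => x Xx.
  have Xc : `|coding (fun i => w (m + i)%N) : R| <= 2^-1 by exact: coding_le.
  have := prefix_contract m Ew Xx Xc; rewrite -coding_shift // => H.
  have : `|x - coding (fun i => w (m + i)%N)| <= 1.
    by move: Xx Xc; rewrite !ler_norml; lra.
  have p0 : 0 < 4^-1 ^+ m :> R by rewrite exprn_gt0 // invr_gt0.
  have := ler_distD (coding w) (phi_word (flatten (mkseq w m)) x) (c i).
  move: Hm H p0; set q := 4^-1 ^+ m; set d := `|x - _|; move=> Hm H p0 tri d1.
  have : q * d <= q by rewrite ler_piMr // ltW.
  lra.
have [i a b ba|i ik|rho rho0 Hrho] := @finite_lower_bound R _ (iota 0 k0)
    (fun i a => a <= 2 * r i).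
- exact: le_trans.
- by exists (2 * r i); rewrite ?mulr_gt0.
have [|k1 Hk1] := @geometric_small R gap 4^-1 rho _ rho0; first by lra.
pose g (w : seq (seq int)) : R -> R := phi_word (flatten w).
(* By distortion both scales in [word_dist] are at least a third of the one at [x0], so [a w] is a
   lower contraction ratio. The division by [9] is the origin of the bound [9 ^ s]. *)
pose a (w : seq (seq int)) := scale (flatten w) x0 ^+ 2 / 9.
have gE W x : foldr g x W = phi_word (flatten (flatten W)) x.
  elim: W => [|w W IH] /=; first by rewrite Defs.phi_word0.
  by rewrite IH /g -phi_word_cat -flatten_cat.
have K_gt0 : 0 < 9 `^ s :> R by rewrite powR_gt0.
have : 1 <= \sum_(i < k0) (2 * r i / gap) `^ s.
  (* Level [k0 + k1] serves twice: since [n >= 1], its words have at least [k0] letters and so lie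
     in one of the [k0] balls, and [k1] puts [gap * 4 ^ (- k1)] below the smallest diameter bound
     [2 * r i]. *)
  apply: (@mass_distribution R _ G g a h s gap h_ge0 _ _ _ gap0 _ _ _ _ (k0 + k1) k0 c r).
  - move=> w x wG Kx; rewrite /g.
    case: w wG => [|t w] wG; first by move: (words_size wG) n_gt0 => <-.
    rewrite /= phi_word_cat; apply: Fh; first by apply: (GF _ wG); exact: mem_head.
    apply: word_stable; last exact: in_X.
    move=> k kw; apply: (GE _ wG).
    by rewrite inE kw orbT.
  - move=> w wG; have /andP[a0 a1] := word_scale_le (GE _ wG) Xx0.
    rewrite /a divr_gt0 ?exprn_gt0 //=.
    have : scale (flatten w) x0 <= 1.
      by apply: le_trans a1 _; rewrite exprn_ile1 //; lra.
    nra.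
  - move=> w x y wG Kx Ky; rewrite /g word_dist ?in_X //; last exact: GE.
    rewrite ler_wpM2r //.
    have := word_distortion (GE _ wG) Xx0 (in_X _ Kx).
    have := word_distortion (GE _ wG) Xx0 (in_X _ Ky).
    have := scale_ge0 (flatten w) x0; rewrite /a.
    move: (scale _ x0) (scale _ x) (scale _ y) => p q o; nra.
  - move=> w v x y wG vG wv Kx Ky; exact: gapP.
  - exact: uniq_words.
  - exact: ltW.
  - have -> : \sum_(w <- G) a w `^ s = Zsum F s n x0 / 9 `^ s.
      rewrite mulr_suml; apply: eq_bigr => w _.
      rewrite /a powRM ?exprn_ge0 ?scale_ge0 ?invr_ge0 //.
      rewrite -powR_mulrn ?scale_ge0 // -powRrM.
      by rewrite -[9^-1]powR_inv1 // -powRrM mulN1r powRN.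
    by rewrite ler_pdivlMr // mul1r ltW.
  - move=> i ik; apply: le_trans (Hrho i _); last by rewrite mem_iota.
    apply: le_trans Hk1; rewrite ler_wpM2l ?(ltW gap0) //.
    by rewrite ler_wiXn2l ?leq_addl //; lra.
  - move=> W Wk WG.
    have WF : {subset flatten W <= F}.
      by move=> t /flattenP[w /WG /GF]; exact.
    have Wsize : (k0 <= size (flatten W))%N.
      rewrite size_flatten sumnE big_map big_seq.
      rewrite (eq_bigr (fun=> n)) => [|w /WG /words_size //].
      rewrite -big_seq big_const_seq count_predT iter_addn_0 Wk.
      by nia.
    have [||i ik Bi] := Hk0 (take k0 (flatten W)).
    + by rewrite size_takel.
    + by move=> t /mem_take /WF.
    exists i => // x Kx; rewrite gE -(cat_take_drop k0 (flatten W)).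
    rewrite flatten_cat phi_word_cat; apply: Bi; apply: word_stable; last exact: in_X.
    by move=> t /mem_drop /WF /EF.
apply/negP; rewrite -ltNge.
have -> : \sum_(i < k0) (2 * r i / gap) `^ s = (2 / gap) `^ s * \sum_(i < k0) r i `^ s.
  rewrite mulr_sumr; apply: eq_bigr => i _.
  by rewrite mulrAC powRM ?(ltW (r0 i)) // divr_ge0 // ltW.
apply: (@le_lt_trans _ _ ((2 / gap) `^ s * ((gap / 2) `^ s / 2))).
  by rewrite ler_wpM2l // powR_ge0.
rewrite mulrA -powRM ?divr_ge0 ?(ltW gap0) //.
have -> : 2 / gap * (gap / 2) = 1 by field; rewrite gt_eqF.
by rewrite powR1; lra.
Qed.

End LowerBound.

(** * The greedy subsystem *)

Section Enumeration.

(* [(code b n j).+1 = 2 ^ n * (2 * (2 * j + b) + 1)] is a bijection onto the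
   positive integers, increasing in [j]: the letters that dominate [letter b n j]
   are enumerated after it. *)
Definition code (b : bool) (n j : nat) : nat := (2 ^ n * (2 * (2 * j + b) + 1)).-1.

(** The inverse of [code]: [n] is the 2-adic valuation of [k.+1], whose odd part is [2 * i + 1] with
    [i = 2 * j + b]. *)
Definition lett (k : nat) : seq int :=
  let n := logn 2 k.+1 in let i := (k.+1 %/ 2 ^ n)./2 in letter (odd i) n i./2.

Lemma codeK b n j : lett (code b n j) = letter b n j.
Proof.
have pos : (0 < 2 ^ n * (2 * (2 * j + b) + 1))%N by rewrite muln_gt0 expn_gt0 addn1.
have lognE : logn 2 (2 ^ n * (2 * (2 * j + b) + 1)) = n.
  rewrite lognM ?expn_gt0 ?addn1 // pfactorK // lognE /=.
  by rewrite dvdn2 /= mul2n odd_double /= addn0.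
rewrite /lett /code prednK // lognE mulKn ?expn_gt0 //.
have -> : ((2 * (2 * j + b) + 1)./2 = 2 * j + b)%N by lia.
by congr letter; lia.
Qed.

Lemma lettP k : exists b n j, k = code b n j /\ lett k = letter b n j.
Proof.
suff [b [n [j E]]] : exists b n j, k = code b n j by exists b, n, j; rewrite E codeK.
set n := logn 2 k.+1; set m := (k.+1 %/ 2 ^ n)%N.
have dv : (2 ^ n %| k.+1)%N by exact: pfactor_dvdnn.
have km : (2 ^ n * m = k.+1)%N by rewrite mulnC divnK.
have m_odd : odd m.
  have m0 : (0 < m)%N by move: (ltn0Sn k); rewrite -km muln_gt0 => /andP[].
  have : logn 2 (2 ^ n * m) = n by rewrite km.
  rewrite lognM ?expn_gt0 // pfactorK // => /eqP; rewrite -[X in _ == X]addn0 eqn_add2l.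
  by rewrite lognE m0 /= dvdn2; case: (odd m).
exists (odd m./2), n, m./2./2; rewrite /code.
have -> : (2 * (2 * m./2./2 + odd m./2) + 1 = m)%N by lia.
by rewrite km.
Qed.

Lemma lett_Ebar k : Ebar (lett k).
Proof. by have [b [n [j [_ ->]]]] := lettP k; exact: Ebar_letter. Qed.

Lemma lett_surj tau : Ebar tau -> exists k, tau = lett k.
Proof. by case/EbarP=> b [n [j ->]]; exists (code b n j); rewrite codeK. Qed.

Lemma lett_inj : injective lett.
Proof.
move=> k k'; have [b [n [j [-> ->]]]] := lettP k.
by have [b' [n' [j' [-> ->]]]] := lettP k' => /letter_inj[-> -> ->].
Qed.

Lemma code_ltn b n j i : (0 < i)%N -> (code b n j < code b n (j + i))%N.
Proof.
move=> i0; rewrite /code ltn_predRL prednK ?muln_gt0 ?expn_gt0 ?addn1 //.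
by rewrite ltn_pmul2l ?expn_gt0 //; lia.
Qed.

(** The scale is at most [2 ^ (- n) / (j + 2)], while [k.+1 <= 2 ^ n * (4 * j + 3)]. Hence
    derivatives tend to [0] along the enumeration, uniformly in [x]. *)
Lemma scale_letter_code (R : realType) (k : nat) (x : R) : `|x| <= 2^-1 ->
  scale (lett k) x <= 8 / k.+1%:R.
Proof.
move=> Xx; have [b [n [j [kE ->]]]] := lettP k.
have kS : k.+1 = (2 ^ n * (2 * (2 * j + b) + 1))%N.
  by rewrite kE prednK // muln_gt0 expn_gt0 addn1.
have pos (m i : nat) (y : R) : `|y| <= 2^-1 ->
    scale (letter false m i) y <= 2^-1 ^+ m * (i%:R + 2)^-1.
  move=> Xy; elim: m => [|m IH].
    rewrite letter0 /= Defs.phi_word0 -pmulrn natrD mulr1 expr0 mul1r.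
    have i0 : 0 <= i%:R :> R := ler0n _ _.
    move: Xy; rewrite ler_norml => /andP[y1 y2].
    by rewrite ger0_norm ?lef_pV2 ?posrE; lra.
  rewrite letterS /= exprS -mulrA.
  have /andP[y1 _] := letter_ge0 m i Xy.
  have y0 : 0 <= phi_word (letter false m i) y by apply: le_trans y1; rewrite invr_ge0.
  apply: ler_pM; rewrite ?invr_ge0 ?scale_ge0 //.
  by rewrite ger0_norm ?lef_pV2 ?posrE; lra.
have : scale (letter b n j) x <= 2^-1 ^+ n * (j%:R + 2)^-1.
  by case: {kE kS} b; [rewrite -[x]opprK letterN scaleN pos ?normrN|exact: pos].
move/le_trans; apply; rewrite kS natrM natrX exprVn.
have p0 : 0 < 2 ^+ n :> R by rewrite exprn_gt0.
have j0 : 0 <= j%:R :> R := ler0n _ _.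
rewrite invfM mulrCA ler_wpM2l ?invr_ge0 ?(ltW p0) //.
rewrite ler_pdivlMr ?ltr0n ?addn1 // mulrC ler_pdivrMr; last by lra.
rewrite -addn1 natrD natrM natrD natrM.
have : b%:R <= 1 :> R by case: b {kE kS}.
lra.
Qed.

End Enumeration.

Section Spectrum.
Context {R : realType}.
Implicit Types (D : set (seq int)) (t : R).

Notation lim_set := (limit_set (Xv R) (@phi_word R)).
Notation dim D := (hausdorff_dim (lim_set D)).

Lemma limit_set_subset D D' : D `<=` D' -> lim_set D `<=` lim_set D'.
Proof. by move=> DD x [w Dw wx]; exists w => // i; apply/DD/Dw. Qed.

Lemma dim_subset D D' : D `<=` D' -> (dim D <= dim D')%E.
Proof. by move=> DD; apply/hausdorff_dim_subset/limit_set_subset. Qed.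

Lemma dim_le1 D : D `<=` Ebar -> (dim D <= 1%:E)%E.
Proof.
move=> DE; apply: hausdorff_dim_le1 => x /(@limit_set_cover R D 1 DE isT)[u [Du _]].
case=> y /XvE Xy <-; apply/XvE/word_stable => //.
by move=> k /Du /DE.
Qed.

Lemma Zsum_le_sub D t (F : seq (seq int)) n (x : R) : D `<=` Ebar -> (dim D < t%:E)%E ->
  uniq F -> word_on D F -> `|x| <= 2^-1 -> Zsum F t n x <= 9 `^ t.
Proof.
move=> DE Dt uF DF Xx; apply: Zsum_le_of_dim => //.
  by move=> k /DF /DE.
by apply: le_lt_trans Dt; apply: dim_subset => k /= /DF.
Qed.

Lemma dim_lt_split D t : (dim D < t%:E)%E ->
  exists2 s, 0 <= s & (dim D < s%:E)%E /\ s < t.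
Proof.
move=> Dt; have D0 : (0 <= dim D)%E by exact: hausdorff_dim_ge0.
have Df : dim D \is a fin_num.
  by rewrite ge0_fin_numE // (lt_trans Dt) // ltry.
move: Dt D0; rewrite -(fineK Df) lte_fin lee_fin => Dt D0.
by exists ((fine (dim D) + t) / 2); [lra|rewrite lte_fin; split; lra].
Qed.

(** The bound on partition functions from [Zsum_le_of_dim] depends on the exponent only, not on [F],
    so it is uniform over finite subsystems and yields the upper bound for [D]. *)
Lemma dim_finite_character D t : D `<=` Ebar -> 0 <= t ->
  (forall F : seq (seq int), uniq F -> word_on D F -> (dim [set` F] <= t%:E)%E) ->
  (dim D <= t%:E)%E.
Proof.
move=> DE t0 H; apply/lee_addgt0Pr => e e0; rewrite -EFinD.
apply: (@dim_limit_set_le R D (t + e) (9 `^ (t + e))) => //; first by lra.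
move=> F n uF DF; apply: (@Zsum_le_sub [set` F]) => //.
- by move=> k /= /DF /DE.
- by apply: le_lt_trans (H F uF DF) _; rewrite lte_fin; lra.
- by rewrite normr0 invr_ge0.
Qed.

Lemma dim_add_small D t : D `<=` Ebar -> (dim D < t%:E)%E ->
  exists N, forall k, (N <= k)%N -> (dim (D `|` [set lett k]) <= t%:E)%E.
Proof.
move=> DE /dim_lt_split[s s0 [Ds st]].
have K0 : 0 < 9 `^ s :> R by rewrite powR_gt0.
have [e e0 [M HM]] := Zsum_add_small st K0.
have t0 : 0 < t by lra.
pose d := e `^ (2 * t)^-1.
have d0 : 0 < d by rewrite powR_gt0.
exists (Num.truncn (8 / d)) => k kN.
have sk (x : R) : `|x| <= 2^-1 -> scale (lett k) x `^ (2 * t) <= e.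
  move=> Xx; have -> : e = d `^ (2 * t).
    by rewrite -powRrM mulVf ?powRr1 ?(ltW e0) // gt_eqF //; lra.
  apply: ge0_ler_powR; rewrite ?nnegrE ?scale_ge0 ?(ltW d0) //; first lra.
  apply: le_trans (scale_letter_code k Xx) _.
  rewrite ler_pdivrMr // mulrC -ler_pdivrMr // ltW //.
  by apply: lt_le_trans (truncnS_gt _) _; rewrite ler_nat.
apply: (@dim_limit_set_le R _ t M).
- by move=> tau [/DE//|/= ->]; exact: lett_Ebar.
- exact: ltW.
(* Removing the new letter from [F] leaves a finite subsystem of [D], whose partition functions at
   exponent [s] are bounded. *)
move=> F n uF DF; pose F' := [seq tau <- F | tau != lett k].
have X0 := @norm0_le_half R.
have DF' : word_on D F'.
  by move=> tau; rewrite mem_filter => /andP[/eqP ne /DF[//|/= /ne]].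
apply: (@le_trans _ _ (Zsum (lett k :: F') t n 0)).
  apply: Zsum_subset => // tau tF; rewrite inE mem_filter tF andbT.
  by case: eqVneq.
apply: HM => //; first by move=> tau /DF' /DE.
- exact: lett_Ebar.
- move=> m x Xx; apply: (@Zsum_le_sub D) => //.
  by rewrite filter_uniq.
Qed.

Fixpoint greedy t k : seq (seq int) :=
  if k is m.+1 then
    if `[< dim [set` lett m :: greedy t m] <= t%:E >]%E
    then lett m :: greedy t m else greedy t m
  else [::].

Definition greedy_set t : set (seq int) := [set tau | exists k, tau \in greedy t k].

Lemma greedy_mem t k tau : tau \in greedy t k -> exists2 m, (m < k)%N & tau = lett m.
Proof.
elim: k => [//|k IH] /=; case: ifP => _ => [|/IH[m mk ->]]; last first.
  by exists m => //; exact: ltnW.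
rewrite inE => /orP[/eqP->|/IH[m mk ->]]; first by exists k.
by exists m => //; exact: ltnW.
Qed.

Lemma greedy_uniq t k : uniq (greedy t k).
Proof.
elim: k => [//|k IH] /=; case: ifP => _ //=; rewrite IH andbT.
by apply/negP => /greedy_mem[m mk /lett_inj km]; rewrite km ltnn in mk.
Qed.

Lemma greedy_sub t k l : (k <= l)%N -> {subset greedy t k <= greedy t l}.
Proof.
move=> /subnKC <-; elim: (l - k)%N => [|m IH] tau; first by rewrite addn0.
by move=> /IH; rewrite addnS /=; case: ifP => _ //; rewrite inE orbC => ->.
Qed.

Lemma greedy_Ebar t : greedy_set t `<=` Ebar.
Proof. by move=> _ [k /greedy_mem[m _ ->]]; exact: lett_Ebar. Qed.

Lemma dim_greedy t k : 0 <= t -> (dim [set` greedy t k] <= t%:E)%E.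
Proof.
move=> t0; elim: k => [|k IH] /=; last by case: ifPn => // /asboolP.
apply: (@dim_limit_set_le R _ t 1) => // F n _ F0.
case: F F0 => [_|a F /(_ a (mem_head _ _))//].
by case: n => [|n]; rewrite ?Zsum0 // ZsumS big_nil.
Qed.

Lemma dim_greedy_set t : 0 <= t -> (dim (greedy_set t) <= t%:E)%E.
Proof.
move=> t0; apply: dim_finite_character => //; first exact: greedy_Ebar.
move=> F _ DF; have [k Hk] : exists k, forall tau, tau \in F -> tau \in greedy t k.
  apply: (@finite_max _ F (fun tau k => tau \in greedy t k)) => [tau k l|tau /DF//].
  by move=> kl; apply: greedy_sub kl _.
by apply: le_trans (dim_greedy k t0); apply: dim_subset.
Qed.

Lemma greedy_accept t k : 0 <= t ->
  (dim (greedy_set t `|` [set lett k]) <= t%:E)%E -> greedy_set t (lett k).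
Proof.
move=> t0 H; exists k.+1; rewrite /= ifT ?mem_head //; apply/asboolP.
apply: le_trans H; apply: dim_subset => tau /=.
by rewrite inE => /orP[/eqP->|tk]; [right|left; exists k].
Qed.

End Spectrum.

Theorem theorem2 (R : realType) :
  full_dimension_spectrum (Xv R) (@phi_word R) Ebar.
Proof.
move=> t t0 tE; exists (greedy_set t); first exact: greedy_Ebar.
set D := greedy_set t; have DE : D `<=` Ebar by exact: greedy_Ebar.
apply/eqP; rewrite eq_le dim_greedy_set //= leNgt; apply/negP => Dt.
have [N HN] := dim_add_small DE Dt.
have tail k : (N <= k)%N -> D (lett k) by move=> /HN; exact: greedy_accept.
(* If every letter is accepted, [D] is the whole alphabet, whose dimension is at least [t]. *)
have [all_in|] := pselect (forall k, D (lett k)).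
  have : (hausdorff_dim (limit_set (Xv R) (@phi_word R) Ebar) <=
          hausdorff_dim (limit_set (Xv R) (@phi_word R) D))%E.
    by apply: dim_subset => tau /lett_surj[k ->].
  by move=> /(le_trans tE); rewrite leNgt Dt.
move=> /existsNP[m0 Dm0].
have [m Dm m_last] : exists2 m, ~ D (lett m) & forall k, (m < k)%N -> D (lett k).
  have ex : exists k, `[< ~ D (lett k) >] by exists m0; apply/asboolP.
  have ub k : `[< ~ D (lett k) >] -> (k <= N)%N.
    move=> /asboolP nD; rewrite leqNgt; apply/negP => /ltnW /tail //.
  case: (ex_maxnP ex ub) => m /asboolP Dm m_max; exists m => // k mk.
  apply: contrapT => nD; have /m_max : `[< ~ D (lett k) >] by apply/asboolP.
  by rewrite leqNgt mk.
have [s s0 [Ds st]] := dim_lt_split Dt.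
(* The domination by five letters is available only for exponents at most [1]. *)
have s1 : s <= 1.
  have := le_trans tE (@dim_le1 R Ebar (@subset_refl _ _)).
  by rewrite lee_fin; lra.
have [b [n [j [mE lettE]]]] := lettP m.
set S := greedy t m; have EF : word_on Ebar S.
  by move=> tau tS; apply: DE; exists m.
have nextD : word_on D (next_letters b n j).
  move=> _ /mapP[i i5 ->]; rewrite -codeK; apply: m_last; rewrite mE.
  by apply: code_ltn; move: i5; rewrite mem_iota => /andP[].
(* The letters of [S] have index below [m], the five dominating ones above [m]. *)
have uniqNS : uniq (next_letters b n j ++ S).
  rewrite cat_uniq greedy_uniq andbT; apply/andP; split.
    by rewrite map_inj_uniq ?iota_uniq // => i i' /letter_inj[_ _] /addnI.
  apply/hasPn => _ /greedy_mem[k km ->]; apply/mapP => -[i i5].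
  rewrite -codeK => /lett_inj kE; move: km; rewrite kE mE ltnNge.
  by rewrite ltnW // code_ltn //; move: i5; rewrite mem_iota => /andP[].
suff : (hausdorff_dim (limit_set (Xv R) (@phi_word R) [set` lett m :: S]) <= t%:E)%E.
  move=> H; apply: Dm; exists m.+1; rewrite /= ifT ?mem_head //; exact/asboolP.
apply: (@le_trans _ _ s%:E); last by rewrite lee_fin ltW.
have X0 := @norm0_le_half R.
(* Replacing [lett m] by its five dominating letters gives a finite subsystem of [D], and
   [dim D < s] bounds its partition functions. *)
apply: (@dim_limit_set_le R _ s (9 `^ s)) => //.
  by move=> tau /=; rewrite inE => /orP[/eqP->|/EF//]; exact: lett_Ebar.
move=> F k uF SF; apply: (@le_trans _ _ (Zsum (lett m :: S) s k 0)).
  exact: Zsum_subset.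
rewrite lettE; apply: le_trans (Zsum_replace _ _ _ _ EF _ X0) _; first by rewrite s0.
apply: (@Zsum_le_sub _ D) => // tau; rewrite mem_cat => /orP[/nextD//|tS].
by exists m.
Qed.
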